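(* Let $\mu\in\{-1,0,1\}$ and $T>0$. Let $u_0\in C^1_b(\mathbb{R})$ be real-valued and non-negative, with $u_0^2\in C^3_b(\mathbb{R})$ and $u_0^{4/3}\in C^2_b(\mathbb{R})$. Then there exists at most one hydrodynamic solution $u$ on $[0,T]$ of $$u_t+\left(u(uu_x)_x+\mu u^3\right)_x=0,\qquad u(0)=u_0,$$ such that $u^2\in C([0,T];C^3_b(\mathbb{R}))$ and $u^{4/3}\in C([0,T];C^2_b(\mathbb{R}))$.
   Context: $C^k_b(\mathbb{R})=C^k(\mathbb{R})\cap W^{k,\infty}(\mathbb{R})$ with the $W^{k,\infty}$ norm. Hydrodynamic solution: a non-negative function $u\in C^1([0,T]\times\mathbb{R})$ with $u^2\in C([0,T];C^3(\mathbb{R}))$ is a hydrodynamic solution of the equation above if $u(0,\cdot)=u_0$ and, for all $(t,x)\in[0,T]\times\mathbb{R}$, $$u_t+(bu)_x=0,\qquad b=\tfrac12(u^2)_{xx}+\mu u^2 .$$ *)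

(* Defs.v *)
From Stdlib Require Import Reals Lra.
From Coquelicot Require Import Coquelicot.

Open Scope R_scope.

(* [Rpower 0 a = 1] in the standard library; for [a > 0] this is the power
   function of [[0, +oo)], with value [0] at [0]. *)
Definition nnpow (x a : R) : R := if Rlt_dec 0 x then Rpower x a else 0.

Definition Ck (k : nat) (f : R -> R) : Prop :=
  forall (n : nat) (x : R), (n <= k)%nat ->
    ex_derive_n f n x /\ continuous (Derive_n f n) x.

(* [W^{k,oo}] restricted to [C^k], where weak derivatives are classical ones
   and essential suprema are suprema. *)
Definition Ckb (k : nat) (f : R -> R) : Prop :=
  Ck k f /\
  forall n : nat, (n <= k)%nat ->
    exists M : R, forall x : R, Rabs (Derive_n f n x) <= M.

Definition supnorm (f : R -> R) : Rbar :=
  Lub_Rbar (fun y => exists x, y = Rabs (f x)).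

(* Meaningful on [Ckb k] only: [real p_infty = 0]. *)
Definition Wnorm (k : nat) (f : R -> R) : R :=
  sum_f_R0 (fun n => real (supnorm (Derive_n f n))) k.

(* Functions of [(t, x)] are total in [t], but only their values for
   [0 <= t <= T] are ever constrained: limits in [t] are taken within
   [[0, T]], hence one-sided at the endpoints. *)
Definition at_time (T t : R) : (R -> Prop) -> Prop :=
  within (fun s => 0 <= s <= T) (locally t).

Definition C_Ckb (T : R) (k : nat) (v : R -> R -> R) : Prop :=
  forall t : R, 0 <= t <= T ->
    Ckb k (v t) /\
    filterlim (fun s => Wnorm k (fun x => v s x - v t x))
              (at_time T t) (locally 0).

(* [C^k(R)] carries its Fréchet topology: uniform convergence on compact sets
   of all derivatives up to order [k]. *)
Definition C_Ck (T : R) (k : nat) (v : R -> R -> R) : Prop :=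
  forall t : R, 0 <= t <= T ->
    Ck k (v t) /\
    forall (n : nat) (r : R) (eps : posreal), (n <= k)%nat ->
      at_time T t (fun s => forall x : R, Rabs x <= r ->
        Rabs (Derive_n (v s) n x - Derive_n (v t) n x) < eps).

Definition continuous_strip (T : R) (f : R -> R -> R) : Prop :=
  forall t x : R, 0 <= t <= T ->
    filterlim (fun p : R * R => f (fst p) (snd p))
              (within (fun p : R * R => 0 <= fst p <= T) (locally (t, x)))
              (locally (f t x)).

Definition is_dt (T : R) (u : R -> R -> R) (t x l : R) : Prop :=
  filterdiff (fun s => u s x) (at_time T t) (fun h => scal h l).

Definition C1_strip (T : R) (u : R -> R -> R) : Prop :=
  continuous_strip T u /\
  exists ut ux : R -> R -> R,
    continuous_strip T ut /\ continuous_strip T ux /\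
    forall t x : R, 0 <= t <= T ->
      is_dt T u t x (ut t x) /\ is_derive (u t) x (ux t x).

Definition velocity (mu : R) (u : R -> R -> R) (t x : R) : R :=
  / 2 * Derive_n (fun y => u t y ^ 2) 2 x + mu * u t x ^ 2.

Definition hydrodynamic_solution
    (mu T : R) (u0 : R -> R) (u : R -> R -> R) : Prop :=
  (forall t x : R, 0 <= t <= T -> 0 <= u t x) /\
  C1_strip T u /\
  C_Ck T 3 (fun t x => u t x ^ 2) /\
  (forall x : R, u 0 x = u0 x) /\
  forall t x : R, 0 <= t <= T ->
    exists ut bux : R,
      is_dt T u t x ut /\
      is_derive (fun y => velocity mu u t y * u t y) x bux /\
      ut + bux = 0.

(* Main.v *)
(** Put r = u^(2/3).  The hypotheses on u^2 and u^(4/3) give that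
    r_x, r r_xx and r^2 r_xxx are bounded, and r solves
    r_t + r^3 r_xxx + 15/2 r^2 r_x r_xx + 5 r r_x^3 + 3 mu r^3 r_x = 0.
    Hence |r_t| <= C r: the zero set of r does not move, and two solutions with
    the same datum stay comparable to that datum.

    For two such r, s and w = r - s, the energy with density r^2 w^2 closes: the
    weight r^2 is the one for which the w_x^2 terms cancel, and every other
    coefficient is bounded by r^2 by homogeneity (r counts 1, each x-derivative
    -1).  As r and s need not decay, the density is multiplied by g^3 with
    g = 1 - e^2 (x - x0)^2 on |x - x0| <= 1/e.  A derivative falling on g costs
    a factor e/g, and e^j g^(3-j) <= C (g^3 + e^3), so the cutoff produces only
    an error e^2 per unit length.  Gronwall gives E(t) <= C e with C independent
    of e, and e -> 0 forces w = 0 at x0. *)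

Require Import Defs.
From Stdlib Require Import Reals Lra Lia Psatz.
From Coquelicot Require Import Coquelicot.

Open Scope R_scope.

(** * The equation for u^(2/3) and the flux identity *)

(** The power 2/3 gives [u^2 = r^3] and [u^(4/3) = r^2], so the [C^3] and [C^2] bounds are bounds on
    a cube and a square of [r], and [r] grows at most linearly away from a zero. The weight exponent
    is forced: with weight [r^m], integrating [-2 g^3 r^(m+3) w w_xxx] by parts leaves
    [3 (m+3) g^3 r^(m+2) r_x w w_xx], while the second-order term of the equation contributes
    [-15 g^3 r^(m+2) r_x w w_xx]; these cancel for [m = 2]. The obstacle is the zero set, where [r]
    need not have three derivatives and which can be any closed set. Its complement is never split
    into intervals: the energy flux vanishes at least quadratically in the distance to a zero, so it
    is differentiable there with derivative 0, and one application of the fundamental theorem of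
    calculus covers the whole interval. In time, [r] is differentiable at a zero only because the
    zero persists; hence the comparison with the datum is made for [u], which is [C^1], and only
    then transferred to [r]. *)

Definition profile_rhs (mu r r1 r2 r3 : R) : R :=
  - (r ^ 3 * r3 + 15 / 2 * r ^ 2 * r1 * r2 + 5 * r * r1 ^ 3
     + 3 * mu * r ^ 3 * r1).

(** Differences of products are telescoped starting with the highest derivative. The coefficients of
    [r3 - s3] and [r2 - s2] then involve [r] alone, as a weight built from [r] requires; the factors
    taken from [s] end up in the coefficients of [r1 - s1] and [r - s]. *)
Definition drift (mu r r1 s1 s2 : R) : R :=
  15 / 2 * r ^ 2 * s2 + 5 * r * (r1 ^ 2 + r1 * s1 + s1 ^ 2) + 3 * mu * r ^ 3.

Definition drift' (mu r r1 r2 s1 s2 s3 : R) : R :=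
  15 * r * r1 * s2 + 15 / 2 * r ^ 2 * s3 + 5 * r1 * (r1 ^ 2 + r1 * s1 + s1 ^ 2)
  + 5 * r * (2 * r1 * r2 + r2 * s1 + r1 * s2 + 2 * s1 * s2)
  + 9 * mu * r ^ 2 * r1.

Definition potential (mu r s s1 s2 s3 : R) : R :=
  (r ^ 2 + r * s + s ^ 2) * s3 + 15 / 2 * (r + s) * s1 * s2 + 5 * s1 ^ 3
  + 3 * mu * (r ^ 2 + r * s + s ^ 2) * s1.

Lemma profile_rhs_diff (mu r r1 r2 r3 s s1 s2 s3 : R) :
  profile_rhs mu r r1 r2 r3 - profile_rhs mu s s1 s2 s3 =
  - (r ^ 3 * (r3 - s3) + 15 / 2 * r ^ 2 * r1 * (r2 - s2)
     + drift mu r r1 s1 s2 * (r1 - s1) + potential mu r s s1 s2 s3 * (r - s)).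
Proof. unfold profile_rhs, drift, potential; field. Qed.

(* [weight'], [weight''] and [weight'''] are the x-derivatives of [g ^ 3 * r ^ 5]
   when the third derivative of [g] vanishes. *)
Definition weight' (g g1 r r1 : R) : R :=
  3 * g ^ 2 * g1 * r ^ 5 + 5 * g ^ 3 * r ^ 4 * r1.

Definition weight'' (g g1 g2 r r1 r2 : R) : R :=
  6 * g * g1 ^ 2 * r ^ 5 + 3 * g ^ 2 * g2 * r ^ 5
  + 30 * g ^ 2 * g1 * r ^ 4 * r1 + 20 * g ^ 3 * r ^ 3 * r1 ^ 2
  + 5 * g ^ 3 * r ^ 4 * r2.

Definition weight''' (g g1 g2 r r1 r2 r3 : R) : R :=
  6 * g1 ^ 3 * r ^ 5 + 18 * g * g1 * g2 * r ^ 5 + 90 * g * g1 ^ 2 * r ^ 4 * r1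
  + 45 * g ^ 2 * g2 * r ^ 4 * r1 + 180 * g ^ 2 * g1 * r ^ 3 * r1 ^ 2
  + 45 * g ^ 2 * g1 * r ^ 4 * r2 + 60 * g ^ 3 * r ^ 2 * r1 ^ 3
  + 60 * g ^ 3 * r ^ 3 * r1 * r2 + 5 * g ^ 3 * r ^ 4 * r3.

(** With [a = g^3 r^5] and [w = r - s], the first four terms differentiate to [-2 a w w_xxx - 3 a' w
    w_xx + a''' w^2 / 2]. The last term absorbs [-2 g^3 r^2 drift w w_x]. *)
Definition flux (mu g g1 g2 r r1 r2 s s1 s2 : R) : R :=
  - 2 * (g ^ 3 * r ^ 5) * (r - s) * (r2 - s2)
  + g ^ 3 * r ^ 5 * (r1 - s1) ^ 2
  - weight' g g1 r r1 * (r - s) * (r1 - s1)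
  + / 2 * weight'' g g1 g2 r r1 r2 * (r - s) ^ 2
  - g ^ 3 * r ^ 2 * drift mu r r1 s1 s2 * (r - s) ^ 2.

(* What is left of the energy density's time derivative once the flux is
   removed; the only term in which [w_xx] survives carries a derivative of [g]. *)
Definition residue_coef (mu g g1 g2 r r1 r2 r3 s s1 s2 s3 : R) : R :=
  - / 2 * weight''' g g1 g2 r r1 r2 r3
  + (3 * g ^ 2 * g1 * r ^ 2 + 2 * g ^ 3 * r * r1) * drift mu r r1 s1 s2
  + g ^ 3 * r ^ 2 * drift' mu r r1 r2 s1 s2 s3
  - 2 * g ^ 3 * r ^ 2 * potential mu r s s1 s2 s3
  + 2 * g ^ 3 * r * profile_rhs mu r r1 r2 r3.

Definition residue (mu g g1 g2 r r1 r2 r3 s s1 s2 s3 : R) : R :=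
  residue_coef mu g g1 g2 r r1 r2 r3 s s1 s2 s3 * (r - s) ^ 2
  + 9 * g ^ 2 * g1 * r ^ 5 * (r - s) * (r2 - s2).

Definition energy_dt (g r s rt st : R) : R :=
  2 * g ^ 3 * r * (r - s) ^ 2 * rt + 2 * g ^ 3 * r ^ 2 * (r - s) * (rt - st).

(** The part of [-3 a' w w_xx] in which the derivative falls on [r] is [-15 g^3 r^4 r_x w w_xx],
    exactly the second-order term of [energy_dt]; only the part with [g1] is left for the residue.
    The derivative 0 of [g2] reflects a quadratic cutoff. *)
Lemma is_derive_flux (mu : R) (g g1 g2 r r1 r2 r3 s s1 s2 s3 : R -> R) (x : R) :
  is_derive g x (g1 x) -> is_derive g1 x (g2 x) -> is_derive g2 x 0 ->
  is_derive r x (r1 x) -> is_derive r1 x (r2 x) -> is_derive r2 x (r3 x) ->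
  is_derive s x (s1 x) -> is_derive s1 x (s2 x) -> is_derive s2 x (s3 x) ->
  is_derive (fun y => flux mu (g y) (g1 y) (g2 y) (r y) (r1 y) (r2 y)
                        (s y) (s1 y) (s2 y)) x
    (energy_dt (g x) (r x) (s x) (profile_rhs mu (r x) (r1 x) (r2 x) (r3 x))
       (profile_rhs mu (s x) (s1 x) (s2 x) (s3 x))
     - residue mu (g x) (g1 x) (g2 x) (r x) (r1 x) (r2 x) (r3 x)
         (s x) (s1 x) (s2 x) (s3 x)).
Proof.
intros Hg Hg1 Hg2 Hr Hr1 Hr2 Hs Hs1 Hs2.
unfold energy_dt; rewrite profile_rhs_diff.
unfold flux, weight', weight'', drift.
auto_derive.
- repeat split; eexists; eassumption.
- change (Derive (fun x => g x) x) with (Derive g x).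
  change (Derive (fun x => g1 x) x) with (Derive g1 x).
  change (Derive (fun x => g2 x) x) with (Derive g2 x).
  change (Derive (fun x => r x) x) with (Derive r x).
  change (Derive (fun x => r1 x) x) with (Derive r1 x).
  change (Derive (fun x => r2 x) x) with (Derive r2 x).
  change (Derive (fun x => s x) x) with (Derive s x).
  change (Derive (fun x => s1 x) x) with (Derive s1 x).
  change (Derive (fun x => s2 x) x) with (Derive s2 x).
  rewrite (is_derive_unique _ _ _ Hg), (is_derive_unique _ _ _ Hg1),
    (is_derive_unique _ _ _ Hg2), (is_derive_unique _ _ _ Hr),
    (is_derive_unique _ _ _ Hr1), (is_derive_unique _ _ _ Hr2),
    (is_derive_unique _ _ _ Hs), (is_derive_unique _ _ _ Hs1),
    (is_derive_unique _ _ _ Hs2).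
  unfold residue, residue_coef, weight''', drift, drift', potential, profile_rhs.
  field.
Qed.

(** * Homogeneous bounds *)

(* [r] has degree (1, 0); the second degree counts powers of [k], which is the
   cutoff plus its inverse width. *)
Definition graded {I : Type} (D : I -> Prop) (r k : I -> R) (m : Z) (l : nat)
    (f : I -> R) : Prop :=
  exists C, forall i, D i -> Rabs (f i) <= C * (powerRZ (r i) m * k i ^ l).

Definition scales {I : Type} (D : I -> Prop) (r k : I -> R) : Prop :=
  exists B, forall i, D i -> 0 < r i <= B /\ 0 < k i <= B.

Lemma scale_pos (r k : R) (m : Z) (l : nat) :
  0 < r -> 0 < k -> 0 < powerRZ r m * k ^ l.
Proof.
intros Hr Hk; apply Rmult_lt_0_compat; [now apply powerRZ_lt | now apply pow_lt].
Qed.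

Lemma graded_nonneg {I : Type} {D : I -> Prop} {r k m l} {f : I -> R} :
  scales D r k -> graded D r k m l f ->
  exists C, 0 <= C /\
    forall i, D i -> Rabs (f i) <= C * (powerRZ (r i) m * k i ^ l).
Proof.
intros [B HB] [C HC]; exists (Rabs C); split; [apply Rabs_pos|]; intros i Di.
apply Rle_trans with (1 := HC i Di), Rmult_le_compat_r; [|apply Rle_abs].
destruct (HB i Di) as [[Hr _] [Hk _]]; now apply Rlt_le, scale_pos.
Qed.

(** Surplus powers of [r] and [k] are at most powers of the bound [B] from [scales], so lowering a
    degree costs only a constant. This is what lets sums take the minimum of two degrees. *)
Lemma graded_weaken {I : Type} (D : I -> Prop) r k m l m' l' (f : I -> R) :
  scales D r k -> graded D r k m l f -> (m' <= m)%Z -> (l' <= l)%nat ->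
  graded D r k m' l' f.
Proof.
intros Hs Hf Hm Hl.
destruct (graded_nonneg Hs Hf) as [C [C0 HC]].
destruct Hs as [B HB].
exists (C * (B ^ Z.to_nat (m - m') * B ^ (l - l'))); intros i Di.
destruct (HB i Di) as [[Hr HrB] [Hk HkB]].
apply Rle_trans with (1 := HC i Di).
replace m with (m' + Z.of_nat (Z.to_nat (m - m')))%Z at 1 by lia.
rewrite powerRZ_add, <- pow_powerRZ by lra.
replace l with (l' + (l - l'))%nat at 1 by lia; rewrite pow_add.
assert (H1 := pow_incr (r i) B (Z.to_nat (m - m')) (conj (Rlt_le _ _ Hr) HrB)).
assert (H2 := pow_incr (k i) B (l - l') (conj (Rlt_le _ _ Hk) HkB)).
assert (P1 := pow_lt (r i) (Z.to_nat (m - m')) Hr).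
assert (P2 := pow_lt (k i) (l - l') Hk).
assert (P3 := scale_pos (r i) (k i) m' l' Hr Hk).
replace (C * _) with (C * ((powerRZ (r i) m' * k i ^ l') *
  (r i ^ Z.to_nat (m - m') * k i ^ (l - l')))) by ring.
rewrite (Rmult_assoc C).
apply Rmult_le_compat_l; [easy|].
rewrite Rmult_comm; apply Rmult_le_compat_r; [lra|].
apply Rmult_le_compat; lra.
Qed.

Lemma graded_plus {I : Type} (D : I -> Prop) r k m l m' l' (f h : I -> R) :
  scales D r k -> graded D r k m l f -> graded D r k m' l' h ->
  graded D r k (Z.min m m') (Nat.min l l') (fun i => f i + h i).
Proof.
intros Hs Hf Hh.
apply (graded_weaken D r k m l (Z.min m m') (Nat.min l l')) in Hf; [|easy|lia|lia].
apply (graded_weaken D r k m' l' (Z.min m m') (Nat.min l l')) in Hh; [|easy|lia|lia].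
destruct Hf as [C HC], Hh as [C' HC']; exists (C + C'); intros i Di.
apply Rle_trans with (1 := Rabs_triang _ _).
specialize (HC i Di); specialize (HC' i Di); lra.
Qed.

Lemma graded_opp {I : Type} (D : I -> Prop) r k m l (f : I -> R) :
  graded D r k m l f -> graded D r k m l (fun i => - f i).
Proof. intros [C HC]; exists C; intros i Di; rewrite Rabs_Ropp; auto. Qed.

Lemma graded_minus {I : Type} (D : I -> Prop) r k m l m' l' (f h : I -> R) :
  scales D r k -> graded D r k m l f -> graded D r k m' l' h ->
  graded D r k (Z.min m m') (Nat.min l l') (fun i => f i - h i).
Proof.
intros Hs Hf Hh; apply graded_plus; [easy | easy | now apply graded_opp].
Qed.

Lemma graded_mult {I : Type} (D : I -> Prop) r k m l m' l' (f h : I -> R) :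
  scales D r k -> graded D r k m l f -> graded D r k m' l' h ->
  graded D r k (m + m') (l + l') (fun i => f i * h i).
Proof.
intros Hs [C HC] [C' HC']; exists (C * C'); intros i Di.
destruct Hs as [B HB], (HB i Di) as [[Hr _] [Hk _]].
rewrite Rabs_mult, powerRZ_add, pow_add by lra.
replace (C * C' * _) with ((C * (powerRZ (r i) m * k i ^ l)) *
  (C' * (powerRZ (r i) m' * k i ^ l'))) by ring.
apply Rmult_le_compat; auto using Rabs_pos.
Qed.

Lemma graded_const {I : Type} (D : I -> Prop) r k (c : R) :
  graded D r k 0 0 (fun _ => c).
Proof. exists (Rabs c); intros i _; simpl; lra. Qed.

Lemma graded_pow {I : Type} (D : I -> Prop) r k m l n (f : I -> R) :
  scales D r k -> graded D r k m l f ->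
  graded D r k (Z.of_nat n * m) (n * l) (fun i => f i ^ n).
Proof.
intros Hs Hf; induction n as [|n IH]; [exact (graded_const D r k 1)|].
replace (Z.of_nat (S n) * m)%Z with (m + Z.of_nat n * m)%Z by lia.
now apply graded_mult.
Qed.

Ltac graded :=
  lazymatch goal with
  | |- graded _ _ _ _ _ (fun i => _ + _) => eapply graded_plus; [eassumption | graded | graded]
  | |- graded _ _ _ _ _ (fun i => _ - _) => eapply graded_minus; [eassumption | graded | graded]
  | |- graded _ _ _ _ _ (fun i => _ * _) => eapply graded_mult; [eassumption | graded | graded]
  | |- graded _ _ _ _ _ (fun i => - _) => eapply graded_opp; graded
  | |- graded _ _ _ _ _ (fun i => _ ^ _) => eapply graded_pow; [eassumption | graded]
  | |- _ => first [eassumption | apply graded_const]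
  end.

Definition jet_bounds {I : Type} (D : I -> Prop) (r k f f1 f2 f3 : I -> R) : Prop :=
  graded D r k 1 0 f /\ graded D r k 0 0 f1 /\
  graded D r k (-1) 0 f2 /\ graded D r k (-2) 0 f3.

Definition cutoff_bounds {I : Type} (D : I -> Prop) (r k g g1 g2 : I -> R) : Prop :=
  graded D r k 0 1 g /\ graded D r k 0 1 g1 /\ graded D r k 0 2 g2.

(** The worst terms carry three derivatives on [r^5], which leaves degree 2 in [r]. A derivative
    falling on the cutoff replaces a factor [g] by [g1] or [g2], which count at least as many powers
    of [k], so degree 3 in [k] survives. *)
Lemma graded_residue_coef {I : Type} (D : I -> Prop) (mu : R)
    {k g g1 g2 r r1 r2 r3 s s1 s2 s3 : I -> R} :
  scales D r k -> cutoff_bounds D r k g g1 g2 ->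
  jet_bounds D r k r r1 r2 r3 -> jet_bounds D r k s s1 s2 s3 ->
  graded D r k 2 3 (fun i => residue_coef mu (g i) (g1 i) (g2 i)
    (r i) (r1 i) (r2 i) (r3 i) (s i) (s1 i) (s2 i) (s3 i)).
Proof.
intros Hs (Hg & Hg1 & Hg2) (Hr & Hr1 & Hr2 & Hr3) (Hs0 & Hs1 & Hs2 & Hs3).
eapply graded_weaken; [eassumption | | |].
- unfold residue_coef, weight''', drift, drift', potential, profile_rhs; graded.
- vm_compute; discriminate.
- vm_compute; lia.
Qed.

(** Serves near zeros of [r]: since [r] is at most linear in the distance to a zero, degree 2 means
    quadratic vanishing of the flux, hence a zero derivative. *)
Lemma graded_flux {I : Type} (D : I -> Prop) (mu : R)
    {k g g1 g2 r r1 r2 r3 s s1 s2 s3 : I -> R} :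
  scales D r k -> cutoff_bounds D r k g g1 g2 ->
  jet_bounds D r k r r1 r2 r3 -> jet_bounds D r k s s1 s2 s3 ->
  graded D r k 2 0 (fun i => flux mu (g i) (g1 i) (g2 i)
    (r i) (r1 i) (r2 i) (s i) (s1 i) (s2 i)).
Proof.
intros Hs (Hg & Hg1 & Hg2) (Hr & Hr1 & Hr2 & Hr3) (Hs0 & Hs1 & Hs2 & Hs3).
eapply graded_weaken; [eassumption | | |].
- unfold flux, weight', weight'', drift; graded.
- vm_compute; discriminate.
- vm_compute; lia.
Qed.

(** The companion for continuity: degree 1 makes the derivative of the flux tend to 0 at zeros of
    [r]. *)
Lemma graded_flux_derivative {I : Type} (D : I -> Prop) (mu : R)
    {k g g1 g2 r r1 r2 r3 s s1 s2 s3 : I -> R} :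
  scales D r k -> cutoff_bounds D r k g g1 g2 ->
  jet_bounds D r k r r1 r2 r3 -> jet_bounds D r k s s1 s2 s3 ->
  graded D r k 1 0 (fun i =>
    energy_dt (g i) (r i) (s i) (profile_rhs mu (r i) (r1 i) (r2 i) (r3 i))
       (profile_rhs mu (s i) (s1 i) (s2 i) (s3 i))
     - residue mu (g i) (g1 i) (g2 i) (r i) (r1 i) (r2 i) (r3 i)
         (s i) (s1 i) (s2 i) (s3 i)).
Proof.
intros Hs (Hg & Hg1 & Hg2) (Hr & Hr1 & Hr2 & Hr3) (Hs0 & Hs1 & Hs2 & Hs3).
eapply graded_weaken; [eassumption | | |].
- unfold energy_dt, residue, residue_coef, weight''', drift, drift', potential, profile_rhs; graded.
- vm_compute; discriminate.
- vm_compute; lia.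
Qed.

(** The index type lets [e] vary with the point, so [C] does not depend on [e]. The [w^2] part is
    controlled by [r^2 k^3 w^2] with [k = g + e]: its [g^3] share is the energy density, its [e^3]
    share is an error because [r w] is bounded. The [w w_xx] part is split by completing a
    square. *)
Lemma residue_bound {I : Type} (D : I -> Prop) (mu : R)
    {e g g1 g2 r r1 r2 r3 s s1 s2 s3 : I -> R} :
  (forall i, D i -> 0 < e i <= 1 /\ 0 <= g i <= 1 /\ Rabs (g1 i) <= 2 * e i) ->
  scales D r (fun i => g i + e i) ->
  cutoff_bounds D r (fun i => g i + e i) g g1 g2 ->
  jet_bounds D r (fun i => g i + e i) r r1 r2 r3 ->
  jet_bounds D r (fun i => g i + e i) s s1 s2 s3 ->
  exists C, 0 <= C /\ forall i, D i ->
    residue mu (g i) (g1 i) (g2 i) (r i) (r1 i) (r2 i) (r3 i)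
      (s i) (s1 i) (s2 i) (s3 i)
    <= C * (g i ^ 3 * r i ^ 2 * (r i - s i) ^ 2) + C * e i ^ 2.
Proof.
intros He Hs Hg Hr Hs'.
pose proof (graded_residue_coef D mu Hs Hg Hr Hs') as HQ.
destruct (graded_nonneg Hs HQ) as [C1 [C1p HC1]].
assert (Hw : graded D r (fun i => g i + e i) 0 0 (fun i => r i * (r i - s i))).
{ destruct Hr as (Hr & _), Hs' as (Hs' & _).
  eapply graded_weaken; [eassumption | graded | | ]; vm_compute; [discriminate | lia]. }
destruct (graded_nonneg Hs Hw) as [C2 [C2p HC2]].
assert (Hw2 : graded D r (fun i => g i + e i) 0 0 (fun i => r i ^ 4 * (r2 i - s2 i))).
{ destruct Hr as (Hr & _ & Hr2 & _), Hs' as (_ & _ & Hs2 & _).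
  eapply graded_weaken; [eassumption | graded | | ]; vm_compute; [discriminate | lia]. }
destruct (graded_nonneg Hs Hw2) as [C3 [C3p HC3]].
(* One constant for both terms: [8 * C1 + 9] multiplies the energy density, the rest multiplies
   [e ^ 2]. *)
exists (8 * C1 + 9 + 8 * C1 * C2 ^ 2 + 9 * C3 ^ 2).
assert (C2q := pow2_ge_0 C2); assert (C3q := pow2_ge_0 C3).
split; [nra|]; intros i Di.
specialize (He i Di) as ([e0 e1] & [g0 gl] & Hg1).
specialize (HC1 i Di); specialize (HC2 i Di); specialize (HC3 i Di).
simpl powerRZ in HC1, HC2, HC3; rewrite pow_O in HC2, HC3.
unfold residue.
set (Q := residue_coef _ _ _ _ _ _ _ _ _ _ _ _) in *.
revert HC1 HC2 HC3 Hg1.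
generalize (r i) (s i) (r2 i) (s2 i) (g1 i).
revert e0 e1 g0 gl; generalize (g i) (e i).
clearbody Q; clear - C1p C2p C3p C2q C3q.
intros g e e0 e1 g0 gl r s r2 s2 g1 HQ Hw Hw2 Hg1.
set (w := r - s) in *; set (w2 := r2 - s2) in *.
rewrite Rmult_1_r, Rmult_1_r in Hw, Hw2.
assert (K3 : (g + e) ^ 3 <= 8 * (g ^ 3 + e ^ 3)).
{ assert (0 <= (g + e) * (g - e) ^ 2) by (apply Rmult_le_pos; [lra|apply pow2_ge_0]). nra. }
assert (W : (r * w) ^ 2 <= C2 ^ 2) by (apply pow_maj_Rabs; lra).
assert (W' := pow2_ge_0 (r * w)).
assert (E3 : e ^ 3 <= e ^ 2) by nra.
assert (T1 : Q * w ^ 2 <= 8 * C1 * (g ^ 3 * r ^ 2 * w ^ 2) + 8 * C1 * C2 ^ 2 * e ^ 2).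
{ apply Rle_trans with (C1 * (r * (r * 1) * (g + e) ^ 3) * w ^ 2).
  - apply Rmult_le_compat_r; [apply pow2_ge_0|]; assert (X := Rle_abs Q); lra.
  - replace (C1 * (r * (r * 1) * (g + e) ^ 3) * w ^ 2)
      with (C1 * ((r * w) ^ 2 * (g + e) ^ 3)) by ring.
    replace (8 * C1 * (g ^ 3 * r ^ 2 * w ^ 2) + 8 * C1 * C2 ^ 2 * e ^ 2)
      with (C1 * (8 * (g ^ 3 * (r * w) ^ 2 + C2 ^ 2 * e ^ 2))) by ring.
    apply Rmult_le_compat_l; [easy|].
    assert ((r * w) ^ 2 * (g + e) ^ 3 <= (r * w) ^ 2 * (8 * (g ^ 3 + e ^ 3)))
      by (now apply Rmult_le_compat_l).
    assert ((r * w) ^ 2 * e ^ 3 <= C2 ^ 2 * e ^ 2).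
    { apply Rmult_le_compat; try easy; apply pow_le; lra. }
    lra. }
assert (T2 : 9 * g ^ 2 * g1 * r ^ 5 * w * w2 <=
             9 * (g ^ 3 * r ^ 2 * w ^ 2) + 9 * C3 ^ 2 * e ^ 2).
{ replace (9 * g ^ 2 * g1 * r ^ 5 * w * w2)
    with (9 * g ^ 2 * (r * w) * (g1 * (r ^ 4 * w2))) by ring.
  replace (g ^ 3 * r ^ 2 * w ^ 2) with (g ^ 3 * (r * w) ^ 2) by ring.
  assert (Z : Rabs (g1 * (r ^ 4 * w2)) <= 2 * e * C3).
  { rewrite Rabs_mult; apply Rmult_le_compat; try apply Rabs_pos; lra. }
  set (z := g1 * _) in *; set (p := r * w) in *.
  assert (Z2 : z ^ 2 <= (2 * e * C3) ^ 2) by (apply pow_maj_Rabs; lra).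
  (* Expanded, this bounds [9 g^2 p z] by [9 g^3 p^2 + (9/4) g z^2], and [z] is of size [e] because
     [g1] is. *)
  assert (S : 0 <= g * (2 * g * p - z) ^ 2)
    by (apply Rmult_le_pos; [lra | apply pow2_ge_0]).
  assert (S2 : g * z ^ 2 <= (2 * e * C3) ^ 2).
  { apply Rle_trans with (1 * z ^ 2); [|lra].
    apply Rmult_le_compat_r; [apply pow2_ge_0 | lra]. }
  nra. }
assert (X0 : 0 <= g ^ 3 * r ^ 2 * w ^ 2).
{ replace (g ^ 3 * r ^ 2 * w ^ 2) with (g ^ 3 * (r * w) ^ 2) by ring.
  apply Rmult_le_pos; [now apply pow_le | easy]. }
assert (Y0 := pow2_ge_0 e).
assert (P := Rmult_le_pos _ _ C1p C2q).
set (X := g ^ 3 * r ^ 2 * w ^ 2) in *; set (Y := e ^ 2) in *.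
assert (P1 := Rmult_le_pos _ _ P X0); assert (P2 := Rmult_le_pos _ _ C3q X0).
assert (P3 := Rmult_le_pos _ _ C1p Y0).
lra.
Qed.

(** * Calculus *)

Lemma nonincreasing_of_derive (T : R) (h h' : R -> R) :
  (forall t, 0 < t < T -> is_derive h t (h' t)) ->
  (forall t, 0 < t < T -> h' t <= 0) ->
  (forall t, 0 <= t <= T -> continuity_pt h t) ->
  forall t, 0 <= t <= T -> h t <= h 0.
Proof.
intros Hd Hs Hc t Ht.
(* The intermediate point may be an endpoint, where the sign of [h'] is unknown; capping the
   derivative at 0 keeps it non-positive there as well. *)
destruct (MVT_gen h 0 t (fun x => Rmin (h' x) 0)) as [c [Hc1 Hc2]].
- rewrite Rmin_left, Rmax_right by lra; intros x Hx.
  rewrite Rmin_left by (apply Hs; lra); apply Hd; lra.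
- rewrite Rmin_left, Rmax_right by lra; intros x Hx; apply Hc; lra.
- assert (H := Rmin_r (h' c) 0); nra.
Qed.

Lemma exp_le (x y : R) : x <= y -> exp x <= exp y.
Proof.
intros [H| ->]; [now apply Rlt_le, exp_increasing | apply Rle_refl].
Qed.

Lemma gronwall (T C d : R) (f f' : R -> R) :
  0 <= C -> 0 <= d ->
  (forall t, 0 < t < T -> is_derive f t (f' t)) ->
  (forall t, 0 < t < T -> f' t <= C * f t + d) ->
  (forall t, 0 <= t <= T -> continuity_pt f t) ->
  f 0 = 0 ->
  forall t, 0 <= t <= T -> f t <= d * T * exp (C * T).
Proof.
intros HC Hd Hf Hle Hc H0 t Ht.
(* The source contributes [d * exp (- C * t) <= d] to the derivative, so subtracting [d * t] makes
   the quantity nonincreasing without any sign condition on [f]. *)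
assert (H : exp (- C * t) * f t - d * t <= exp (- C * 0) * f 0 - d * 0).
{ apply (nonincreasing_of_derive T (fun t => exp (- C * t) * f t - d * t)
    (fun t => exp (- C * t) * (f' t - C * f t) - d)); [| | |easy].
  - intros x Hx; auto_derive; [now exists (f' x); apply Hf|].
    change (Derive (fun x => f x) x) with (Derive f x).
    rewrite (is_derive_unique _ _ _ (Hf x Hx)); ring.
  - intros x Hx; specialize (Hle x Hx).
    assert (P := exp_pos (- C * x)).
    assert (exp (- C * x) <= 1) by (rewrite <- exp_0; apply exp_le; nra).
    apply Rle_trans with (exp (- C * x) * d - d); [|nra].
    apply Rplus_le_compat_r, Rmult_le_compat_l; lra.
  - intros x Hx; apply continuity_pt_minus; [apply continuity_pt_mult; [|now apply Hc]|].
    + apply continuity_pt_filterlim.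
      apply (ex_derive_continuous (fun t => exp (- C * t))); auto_derive; easy.
    + apply continuity_pt_filterlim.
      apply (ex_derive_continuous (fun t => d * t)); auto_derive; easy. }
rewrite H0 in H.
assert (P : exp (- C * t) * f t <= d * T) by nra.
assert (E : f t = exp (C * t) * (exp (- C * t) * f t)).
{ rewrite <- Rmult_assoc, <- exp_plus.
  replace (C * t + - C * t) with 0 by ring; rewrite exp_0; ring. }
rewrite E, (Rmult_comm (d * T)).
apply Rle_trans with (exp (C * t) * (d * T)).
- apply Rmult_le_compat_l; [apply Rlt_le, exp_pos | easy].
- apply Rmult_le_compat_r; [nra | apply exp_le; nra].
Qed.

Lemma continuous_slice (f : R -> R -> R) (t x : R) :
  continuity_2d_pt f t x -> continuous (f t) x.
Proof.
intros H; apply continuity_pt_filterlim; intros eps Heps.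
destruct (H (mkposreal eps Heps)) as [d Hd].
exists d; split; [apply cond_pos|]; intros y [_ Hy].
apply Hd; [rewrite Rminus_diag, Rabs_R0; apply cond_pos | exact Hy].
Qed.

Lemma ex_RInt_slice (f : R -> R -> R) (t a b : R) :
  (forall x, continuity_2d_pt f t x) -> ex_RInt (f t) a b.
Proof.
intros H; apply (ex_RInt_continuous (V := R_CompleteNormedModule)); intros z _.
now apply continuous_slice.
Qed.

Lemma continuity_RInt (f : R -> R -> R) (a b t : R) :
  a <= b -> (forall s x, continuity_2d_pt f s x) ->
  continuity_pt (fun s => RInt (f s) a b) t.
Proof.
intros Hab Hf eps Heps.
destruct (uniform_continuity_2d_1d' f a b t (fun x _ => Hf t x)
  (mkposreal (eps / (2 * (b - a + 1))) ltac:(apply Rdiv_lt_0_compat; lra)))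
  as [d Hd]; simpl in Hd.
exists d; split; [apply cond_pos|]; intros s [_ Hs]; simpl in *.
unfold R_dist in *.
change (RInt (f s) a b - RInt (f t) a b) with
  (minus (RInt (f s) a b) (RInt (f t) a b)).
rewrite <- RInt_minus by (now apply ex_RInt_slice).
apply Rle_lt_trans with ((b - a) * (eps / (2 * (b - a + 1)))).
- apply abs_RInt_le_const; [easy| |].
  + apply (ex_RInt_minus (V := R_CompleteNormedModule)); now apply ex_RInt_slice.
  + intros x Hx; apply Rlt_le, (Hd x t x s); try lra.
    * assert (P := cond_pos d); lra.
    * assert (P := Rabs_def2 _ _ Hs); lra.
    * rewrite Rminus_diag, Rabs_R0; apply cond_pos.
- replace ((b - a) * (eps / (2 * (b - a + 1))))
    with (eps * ((b - a) / (2 * (b - a + 1)))) by (field; lra).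
  rewrite <- (Rmult_1_r eps) at 2; apply Rmult_lt_compat_l; [easy|].
  apply Rmult_lt_reg_r with (2 * (b - a + 1)); [lra|].
  unfold Rdiv; rewrite Rmult_assoc, Rinv_l; lra.
Qed.

(** Replaces the chain rule at zeros of the datum, where the spatial jets of a profile are
    arbitrary. *)
Lemma is_derive_zero_of_quadratic (f : R -> R) (z C : R) :
  f z = 0 -> locally z (fun x => Rabs (f x) <= C * (x - z) ^ 2) ->
  is_derive f z 0.
Proof.
intros Hz Hq; apply is_derive_Reals; intros eps Heps.
destruct Hq as [d Hd].
assert (P : 0 < Rmin d (eps / (Rabs C + 1))).
{ apply Rmin_pos; [apply cond_pos | apply Rdiv_lt_0_compat; [easy|]].
  assert (X := Rabs_pos C); lra. }
exists (mkposreal _ P); simpl; intros h Hh Hlt.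
assert (H1 := Rlt_le_trans _ _ _ Hlt (Rmin_l _ _)).
assert (H2 := Rlt_le_trans _ _ _ Hlt (Rmin_r _ _)).
assert (B : Rabs (f (z + h)) <= C * h ^ 2).
{ replace h with (z + h - z) at 2 by ring; apply Hd.
  change (Rabs (z + h - z) < d); now replace (z + h - z) with h by ring. }
rewrite Hz, !Rminus_0_r; unfold Rdiv; rewrite Rabs_mult, Rabs_inv.
assert (Ph := Rabs_pos_lt h Hh).
apply Rmult_lt_reg_r with (Rabs h); [easy|].
rewrite Rmult_assoc, Rinv_l, Rmult_1_r by lra.
apply Rle_lt_trans with (1 := B).
rewrite <- pow2_abs.
apply Rle_lt_trans with ((Rabs C + 1) * Rabs h * Rabs h).
- simpl; assert (X := Rle_abs C); nra.
- apply Rmult_lt_compat_r; [easy|].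
  assert (X := Rabs_pos C).
  apply Rmult_lt_compat_l with (r := Rabs C + 1) in H2; [|lra].
  replace ((Rabs C + 1) * (eps / (Rabs C + 1))) with eps in H2 by (field; lra).
  easy.
Qed.

Lemma continuous_zero_of_lipschitz (f : R -> R) (z C : R) :
  f z = 0 -> locally z (fun x => Rabs (f x) <= C * Rabs (x - z)) ->
  continuous f z.
Proof.
intros Hz [d Hd]; apply continuity_pt_filterlim; intros eps Heps.
assert (X := Rabs_pos C).
exists (Rmin d (eps / (Rabs C + 1))); split.
- apply Rmin_pos; [apply cond_pos | apply Rdiv_lt_0_compat; lra].
- intros x [_ Hx]; simpl in *; unfold R_dist in *.
  assert (H1 := Rlt_le_trans _ _ _ Hx (Rmin_l _ _)).
  assert (H2 := Rlt_le_trans _ _ _ Hx (Rmin_r _ _)).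
  rewrite Hz, Rminus_0_r; apply Rle_lt_trans with (1 := Hd x H1).
  apply Rle_lt_trans with ((Rabs C + 1) * Rabs (x - z)).
  + assert (Y := Rle_abs C); assert (Y' := Rabs_pos (x - z)); nra.
  + apply Rmult_lt_compat_l with (r := Rabs C + 1) in H2; [|lra].
    replace ((Rabs C + 1) * (eps / (Rabs C + 1))) with eps in H2 by (field; lra).
    easy.
Qed.

(** * Profiles *)

(* [r] stands for u^(2/3) and [M] gathers all the constants.  Where [r0]
   vanishes [r1], [r2], [r3] are arbitrary; [profile_equation] still holds there,
   since then [r] and [rt] vanish and [profile_rhs] has a factor [r]. *)
Record profile (mu T M : R) (r0 : R -> R) (r rt r1 r2 r3 : R -> R -> R) : Prop := {
  profile_continuous : forall t x, continuity_2d_pt r t x;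
  profile_init : forall x, r 0 x = r0 x;
  profile_bounds : forall t x, 0 <= t <= T -> 0 <= r t x <= M;
  profile_comparable : forall t x, 0 <= t <= T ->
    r0 x <= M * r t x /\ r t x <= M * r0 x;
  profile_init_zero : forall z x, r0 z = 0 -> r0 x <= M * Rabs (x - z);
  profile_dt : forall t x, 0 < t < T -> is_derive (fun s => r s x) t (rt t x);
  profile_dt_continuous : forall t x, 0 < t < T -> continuity_2d_pt rt t x;
  profile_equation : forall t x, 0 < t < T ->
    rt t x = profile_rhs mu (r t x) (r1 t x) (r2 t x) (r3 t x);
  profile_dx : forall t x, 0 < t < T -> 0 < r0 x ->
    is_derive (r t) x (r1 t x) /\ is_derive (r1 t) x (r2 t x) /\
    is_derive (r2 t) x (r3 t x) /\ continuous (r3 t) x;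
  profile_dx_bounds : forall t x, 0 < t < T -> 0 < r0 x ->
    Rabs (r1 t x) <= M /\ Rabs (r t x * r2 t x) <= M /\
    Rabs (r t x ^ 2 * r3 t x) <= M }.

Arguments profile_continuous {mu T M r0 r rt r1 r2 r3} _.
Arguments profile_init {mu T M r0 r rt r1 r2 r3} _.
Arguments profile_bounds {mu T M r0 r rt r1 r2 r3} _.
Arguments profile_comparable {mu T M r0 r rt r1 r2 r3} _.
Arguments profile_init_zero {mu T M r0 r rt r1 r2 r3} _.
Arguments profile_dt {mu T M r0 r rt r1 r2 r3} _.
Arguments profile_dt_continuous {mu T M r0 r rt r1 r2 r3} _.
Arguments profile_equation {mu T M r0 r rt r1 r2 r3} _.
Arguments profile_dx {mu T M r0 r rt r1 r2 r3} _.
Arguments profile_dx_bounds {mu T M r0 r rt r1 r2 r3} _.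

Lemma profile_init_bounds {mu T M r0 r rt r1 r2 r3} x :
  0 < T -> profile mu T M r0 r rt r1 r2 r3 -> 0 <= r0 x <= M.
Proof.
intros HT Hr; rewrite <- (profile_init Hr).
apply (profile_bounds Hr); lra.
Qed.

Lemma profile_pos {mu T M r0 r rt r1 r2 r3 t x} :
  profile mu T M r0 r rt r1 r2 r3 -> 0 <= t <= T -> 0 < r0 x -> 0 < r t x.
Proof.
intros Hr Ht Hx.
destruct (profile_comparable Hr t x Ht) as [H _].
destruct (profile_bounds Hr t x Ht) as [H' _].
destruct H'; [easy|]; rewrite <- H0, Rmult_0_r in H; lra.
Qed.

Lemma profile_zero {mu T M r0 r rt r1 r2 r3 t x} :
  profile mu T M r0 r rt r1 r2 r3 -> 0 <= t <= T -> r0 x = 0 -> r t x = 0.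
Proof.
intros Hr Ht Hx.
destruct (profile_comparable Hr t x Ht) as [_ H].
destruct (profile_bounds Hr t x Ht) as [H' _].
rewrite Hx in H; lra.
Qed.

(** Both solutions are graded by powers of the same [r]. Passing through the common datum gives
    [s <= M * r0 <= M * M * r] and the reverse, so negative powers of [s] and of [r] are
    interchangeable up to constants. The case [s = r] is used too. *)
Lemma jet_bounds_profile {I : Type} (D : I -> Prop) (k tau xi : I -> R)
    {mu T M r0 r rt r1 r2 r3 s st s1 s2 s3} :
  0 < T ->
  (forall i, D i -> 0 < tau i < T /\ 0 < r0 (xi i)) ->
  profile mu T M r0 r rt r1 r2 r3 -> profile mu T M r0 s st s1 s2 s3 ->
  jet_bounds D (fun i => r (tau i) (xi i)) k (fun i => s (tau i) (xi i))
    (fun i => s1 (tau i) (xi i)) (fun i => s2 (tau i) (xi i))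
    (fun i => s3 (tau i) (xi i)).
Proof.
intros HT HD Hr Hs.
assert (HM : 0 <= M).
{ assert (X := profile_init_bounds 0 HT Hr); lra. }
assert (H : forall i, D i -> let R := r (tau i) (xi i) in let S := s (tau i) (xi i) in
  0 < R /\ 0 < S /\ S <= M * M * R /\ / S <= M * M * / R /\
  Rabs (s1 (tau i) (xi i)) <= M /\ Rabs (S * s2 (tau i) (xi i)) <= M /\
  Rabs (S ^ 2 * s3 (tau i) (xi i)) <= M).
{ intros i Di; destruct (HD i Di) as [Ht Hx]; intros R S.
  assert (Ht' : 0 <= tau i <= T) by lra.
  assert (PR := profile_pos Hr Ht' Hx).
  assert (PS := profile_pos Hs Ht' Hx).
  destruct (profile_comparable Hr _ (xi i) Ht') as [A1 A2].
  destruct (profile_comparable Hs _ (xi i) Ht') as [B1 B2].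
  fold R in PR, A1, A2; fold S in PS, B1, B2.
  repeat split; try easy.
  - nra.
  - apply Rmult_le_reg_l with S; [easy|]; rewrite Rinv_r by lra.
    apply Rmult_le_reg_r with R; [easy|].
    replace (S * (M * M * / R) * R) with (M * (M * S)) by (field; lra).
    nra.
  - apply (profile_dx_bounds Hs); easy.
  - apply (profile_dx_bounds Hs); easy.
  - apply (profile_dx_bounds Hs); easy. }
split; [|split; [|split]].
- exists (M * M); intros i Di; destruct (H i Di) as (PR & PS & A & _).
  simpl; rewrite Rabs_pos_eq by lra; lra.
- exists M; intros i Di; destruct (H i Di) as (PR & PS & _ & _ & A & _).
  simpl; lra.
- exists (M * (M * M)); intros i Di.
  destruct (H i Di) as (PR & PS & _ & A & _ & B & _).
  replace (s2 (tau i) (xi i)) with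
    (s (tau i) (xi i) * s2 (tau i) (xi i) * / s (tau i) (xi i)) by (field; lra).
  rewrite Rabs_mult, Rabs_inv, (Rabs_pos_eq (s _ _)) by lra.
  simpl; rewrite !Rmult_1_r, (Rmult_assoc M).
  apply Rmult_le_compat; try easy; [apply Rabs_pos|].
  now apply Rlt_le, Rinv_0_lt_compat.
- exists (M * ((M * M) * (M * M))); intros i Di.
  destruct (H i Di) as (PR & PS & _ & A & _ & _ & B).
  assert (Q := Rinv_0_lt_compat _ PS).
  replace (s3 (tau i) (xi i)) with
    (s (tau i) (xi i) ^ 2 * s3 (tau i) (xi i) *
     (/ s (tau i) (xi i) * / s (tau i) (xi i))) by (field; lra).
  rewrite Rabs_mult, (Rabs_pos_eq (_ * / s _ _)) by nra.
  change (powerRZ (r (tau i) (xi i)) (-2)) with (/ (r (tau i) (xi i) ^ 2)).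
  rewrite pow_O, Rmult_1_r.
  replace (M * (M * M * (M * M)) * / r (tau i) (xi i) ^ 2) with
   (M * ((M * M * / r (tau i) (xi i)) * (M * M * / r (tau i) (xi i)))) by (field; lra).
  apply Rmult_le_compat; try easy; [apply Rabs_pos | nra |].
  apply Rmult_le_compat; lra.
Qed.

(** * The cutoff, and the flux across the zero set *)

(** Not truncated: it remains a polynomial with zero third derivative, and every integral runs over
    [|x - x0| <= 1/e], where it is nonnegative. *)
Definition cutoff (e x0 x : R) : R := 1 - e ^ 2 * (x - x0) ^ 2.
Definition cutoff' (e x0 x : R) : R := - 2 * e ^ 2 * (x - x0).
Definition cutoff'' (e : R) : R := - 2 * e ^ 2.

Lemma is_derive_cutoff e x0 x : is_derive (cutoff e x0) x (cutoff' e x0 x).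
Proof. unfold cutoff, cutoff'; auto_derive; [easy | ring]. Qed.

Lemma is_derive_cutoff' e x0 x : is_derive (cutoff' e x0) x (cutoff'' e).
Proof. unfold cutoff', cutoff''; auto_derive; [easy | ring]. Qed.

Lemma flux_zero mu g g1 g2 r1 r2 s1 s2 : flux mu g g1 g2 0 r1 r2 0 s1 s2 = 0.
Proof. unfold flux, weight', weight''; ring. Qed.

Lemma residue_zero mu g g1 g2 r1 r2 r3 s1 s2 s3 :
  residue mu g g1 g2 0 r1 r2 r3 0 s1 s2 s3 = 0.
Proof. unfold residue; ring. Qed.

Lemma energy_dt_zero g rt st : energy_dt g 0 0 rt st = 0.
Proof. unfold energy_dt; ring. Qed.

Lemma continuous_pow (f : R -> R) (n : nat) (x : R) :
  continuous f x -> continuous (fun y => f y ^ n) x.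
Proof.
intros Hf; induction n as [|n IH]; [apply continuous_const|].
now apply (continuous_mult (K := R_AbsRing) f (fun y => f y ^ n)).
Qed.

Ltac continuous_poly :=
  lazymatch goal with
  | |- continuous (fun y => @?a y + @?b y) _ =>
      apply (continuous_plus (V := R_NormedModule) a b); continuous_poly
  | |- continuous (fun y => @?a y - @?b y) _ =>
      apply (continuous_minus (V := R_NormedModule) a b); continuous_poly
  | |- continuous (fun y => @?a y * @?b y) _ =>
      apply (continuous_mult (K := R_AbsRing) a b); continuous_poly
  | |- continuous (fun y => - @?a y) _ =>
      apply (continuous_opp (V := R_NormedModule) a); continuous_poly
  | |- continuous (fun y => @?a y ^ ?n) _ =>
      apply (continuous_pow a n); continuous_poly
  | |- _ => first [eassumption | apply continuous_const]
  end.

Lemma continuous_residue mu (g g1 g2 r r1 r2 r3 s s1 s2 s3 : R -> R) x :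
  continuous g x -> continuous g1 x -> continuous g2 x ->
  continuous r x -> continuous r1 x -> continuous r2 x -> continuous r3 x ->
  continuous s x -> continuous s1 x -> continuous s2 x -> continuous s3 x ->
  continuous (fun x => energy_dt (g x) (r x) (s x)
      (profile_rhs mu (r x) (r1 x) (r2 x) (r3 x))
      (profile_rhs mu (s x) (s1 x) (s2 x) (s3 x))
    - residue mu (g x) (g1 x) (g2 x) (r x) (r1 x) (r2 x) (r3 x)
         (s x) (s1 x) (s2 x) (s3 x)) x.
Proof.
intros; unfold energy_dt, residue, residue_coef, weight''', drift, drift',
  potential, profile_rhs.
continuous_poly.
Qed.

Lemma is_derive_continuous (f : R -> R) (x l : R) :
  is_derive f x l -> continuous f x.
Proof.
intros H; apply (ex_derive_continuous (K := R_AbsRing) (V := R_NormedModule)).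
now exists l.
Qed.

(** Where [r0 > 0] this is the algebraic identity. At a zero [z] of [r0], [profile_init_zero] and
    comparability give [r <= M^2 |x - z|], so the graded bounds make [f] quadratic and [f'] linear
    in [|x - z|]. *)
Lemma flux_derive_everywhere {mu T M r0 r rt r1 r2 r3 s st s1 s2 s3} (e x0 t z : R) :
  0 < T -> 0 < t < T ->
  profile mu T M r0 r rt r1 r2 r3 -> profile mu T M r0 s st s1 s2 s3 ->
  let f := fun x => flux mu (cutoff e x0 x) (cutoff' e x0 x) (cutoff'' e)
    (r t x) (r1 t x) (r2 t x) (s t x) (s1 t x) (s2 t x) in
  let f' := fun x => energy_dt (cutoff e x0 x) (r t x) (s t x) (rt t x) (st t x)
    - residue mu (cutoff e x0 x) (cutoff' e x0 x) (cutoff'' e)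
        (r t x) (r1 t x) (r2 t x) (r3 t x) (s t x) (s1 t x) (s2 t x) (s3 t x) in
  is_derive f z (f' z) /\ continuous f' z.
Proof.
intros HT Ht Hr Hs f f'.
set (F' := fun x => energy_dt (cutoff e x0 x) (r t x) (s t x)
      (profile_rhs mu (r t x) (r1 t x) (r2 t x) (r3 t x))
      (profile_rhs mu (s t x) (s1 t x) (s2 t x) (s3 t x))
    - residue mu (cutoff e x0 x) (cutoff' e x0 x) (cutoff'' e)
        (r t x) (r1 t x) (r2 t x) (r3 t x) (s t x) (s1 t x) (s2 t x) (s3 t x)).
assert (EF : forall x, F' x = f' x).
{ intros x; unfold F', f'.
  rewrite <- (profile_equation Hr t x Ht).
  now rewrite <- (profile_equation Hs t x Ht). }
rewrite <- EF.
cut (is_derive f z (F' z) /\ continuous F' z).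
{ intros [H1 H2]; split; [easy|]; now apply (continuous_ext F'). }
assert (Ht' : 0 <= t <= T) by lra.
destruct (profile_init_bounds z HT Hr) as [[Hz|Hz] HM].
- destruct (profile_dx Hr t z Ht Hz) as (A1 & A2 & A3 & A4).
  destruct (profile_dx Hs t z Ht Hz) as (B1 & B2 & B3 & B4).
  split.
  + apply (is_derive_flux mu (cutoff e x0) (cutoff' e x0) (fun _ => cutoff'' e)
      (r t) (r1 t) (r2 t) (r3 t) (s t) (s1 t) (s2 t) (s3 t)); try assumption.
    * apply is_derive_cutoff.
    * apply is_derive_cutoff'.
    * apply (is_derive_const (K := R_AbsRing) (V := R_NormedModule)).
  + unfold F'.
    refine (continuous_residue mu (cutoff e x0) (cutoff' e x0) (fun _ => cutoff'' e)
      (r t) (r1 t) (r2 t) (r3 t) (s t) (s1 t) (s2 t) (s3 t) z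
      (is_derive_continuous _ _ _ (is_derive_cutoff e x0 z))
      (is_derive_continuous _ _ _ (is_derive_cutoff' e x0 z))
      (continuous_const _ _)
      (is_derive_continuous _ _ _ A1) (is_derive_continuous _ _ _ A2)
      (is_derive_continuous _ _ _ A3) A4
      (is_derive_continuous _ _ _ B1) (is_derive_continuous _ _ _ B2)
      (is_derive_continuous _ _ _ B3) B4).
- symmetry in Hz.
  (* Here [e] and [t] are fixed and only [x] varies, so the second scale can be the constant 1; [B]
     bounds [|x - x0|] on this neighbourhood. *)
  set (D := fun x => Rabs (x - z) < 1 /\ 0 < r0 x).
  set (B := 1 + Rabs (z - x0)).
  assert (HB : forall x, D x -> Rabs (x - x0) <= B).
  { intros x [Hx _]; unfold B; replace (x - x0) with (x - z + (z - x0)) by ring.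
    assert (X := Rabs_triang (x - z) (z - x0)); lra. }
  assert (HD : forall x, D x -> 0 < t < T /\ 0 < r0 x) by (now intros x [_ Hx]).
  assert (Jr := jet_bounds_profile D (fun _ => 1) (fun _ => t) (fun x => x)
    HT HD Hr Hr).
  assert (Js := jet_bounds_profile D (fun _ => 1) (fun _ => t) (fun x => x)
    HT HD Hr Hs).
  assert (Sc : scales D (fun x => r t x) (fun _ => 1)).
  { exists (M + 1); intros x [_ Hx].
    assert (P := profile_pos Hr Ht' Hx).
    assert (Q := profile_bounds Hr t x Ht'); lra. }
  assert (Cu : cutoff_bounds D (fun x => r t x) (fun _ => 1) (cutoff e x0) (cutoff' e x0)
                 (fun _ => cutoff'' e)).
  { split; [|split].
    - exists (1 + e ^ 2 * B ^ 2); intros x Hx; specialize (HB x Hx).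
      simpl powerRZ; rewrite pow1, !Rmult_1_r; unfold cutoff.
      assert (X := pow_maj_Rabs _ _ 2 HB).
      assert (Y := pow2_ge_0 (x - x0)); assert (Z := pow2_ge_0 e).
      apply Rabs_le; split; nra.
    - exists (2 * e ^ 2 * B); intros x Hx; specialize (HB x Hx).
      simpl powerRZ; rewrite pow1, !Rmult_1_r; unfold cutoff'.
      assert (Z := pow2_ge_0 e).
      rewrite Rabs_mult, Rabs_left1 by nra; nra.
    - exists (Rabs (cutoff'' e)); intros x _; simpl; lra. }
  assert (HM0 : 0 <= M) by lra.
  assert (RB : forall x, D x -> 0 < r t x <= M * M * Rabs (x - z)).
  { intros x [_ Hx]; split.
    - exact (profile_pos Hr Ht' Hx).
    - assert (P := profile_comparable Hr t x Ht').
      assert (Q := profile_init_zero Hr z x Hz).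
      nra. }
  destruct (graded_nonneg Sc
    (graded_flux D mu Sc Cu Jr Js)) as [C1 [P1 HC1]].
  destruct (graded_nonneg Sc
    (graded_flux_derivative D mu Sc Cu Jr Js)) as [C2 [P2 HC2]].
  (* Other zeros may accumulate at [z]. There every term has a factor [r] or [r - s], so the
     arbitrary jets do no harm. *)
  assert (Z : forall x, r0 x = 0 -> f x = 0 /\ F' x = 0).
  { intros x Hx; unfold f, F'.
    rewrite (profile_zero Hr Ht' Hx).
    rewrite (profile_zero Hs Ht' Hx).
    rewrite flux_zero, residue_zero, energy_dt_zero; lra. }
  destruct (Z z Hz) as [Z1 Z2].
  rewrite Z2; split.
  + apply is_derive_zero_of_quadratic with (C1 * (M * M) ^ 2); [easy|].
    exists (mkposreal 1 Rlt_0_1); intros x Hx.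
    destruct (profile_init_bounds x HT Hr) as [[Px|Px] _].
    * assert (Dx : D x) by (now split).
      specialize (HC1 x Dx); destruct (RB x Dx) as [R1 R2]; fold (f x) in HC1.
      apply Rle_trans with (1 := HC1).
      change (powerRZ (r t x) 2) with (r t x ^ 2); rewrite pow1, Rmult_1_r.
      rewrite Rmult_assoc, <- Rpow_mult_distr; apply Rmult_le_compat_l; [easy|].
      rewrite <- (pow2_abs (M * M * (x - z))), Rabs_mult, (Rabs_pos_eq (M * M)) by nra.
      apply pow_incr; lra.
    * destruct (Z x (eq_sym Px)) as [-> _]; rewrite Rabs_R0.
      apply Rmult_le_pos; [apply Rmult_le_pos; [easy | apply pow2_ge_0] | apply pow2_ge_0].
  + apply continuous_zero_of_lipschitz with (C2 * (M * M)); [easy|].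
    exists (mkposreal 1 Rlt_0_1); intros x Hx.
    destruct (profile_init_bounds x HT Hr) as [[Px|Px] _].
    * assert (Dx : D x) by (now split).
      specialize (HC2 x Dx); destruct (RB x Dx) as [R1 R2]; fold (F' x) in HC2.
      apply Rle_trans with (1 := HC2).
      rewrite pow1, Rmult_1_r, powerRZ_1.
      rewrite Rmult_assoc; apply Rmult_le_compat_l; easy.
    * destruct (Z x (eq_sym Px)) as [_ ->]; rewrite Rabs_R0.
      apply Rmult_le_pos; [nra | apply Rabs_pos].
Qed.

(** Every term of [flux] keeps a factor [g], which vanishes at both ends. The exponent 3 on [g]
    ensures this for [weight''] too, where two derivatives may fall on the cutoff. *)
Lemma is_RInt_flux {mu T M r0 r rt r1 r2 r3 s st s1 s2 s3} (e x0 t : R) :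
  0 < T -> 0 < t < T -> 0 < e ->
  profile mu T M r0 r rt r1 r2 r3 -> profile mu T M r0 s st s1 s2 s3 ->
  is_RInt (fun x => energy_dt (cutoff e x0 x) (r t x) (s t x) (rt t x) (st t x)
    - residue mu (cutoff e x0 x) (cutoff' e x0 x) (cutoff'' e)
        (r t x) (r1 t x) (r2 t x) (r3 t x) (s t x) (s1 t x) (s2 t x) (s3 t x))
    (x0 - / e) (x0 + / e) 0.
Proof.
intros HT Ht He Hr Hs.
assert (H := fun z => flux_derive_everywhere
  e x0 t z HT Ht Hr Hs); simpl in H.
assert (Z : forall y, (y - x0) ^ 2 = / e ^ 2 -> flux mu (cutoff e x0 y) (cutoff' e x0 y) (cutoff'' e)
    (r t y) (r1 t y) (r2 t y) (s t y) (s1 t y) (s2 t y) = 0).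
{ intros y Hy; assert (C0 : cutoff e x0 y = 0) by (unfold cutoff; rewrite Hy; field; lra).
  rewrite C0; unfold flux, weight', weight''; ring. }
assert (I := is_RInt_derive (V := R_CompleteNormedModule) _ _ (x0 - / e) (x0 + / e)
  (fun x _ => proj1 (H x)) (fun x _ => proj2 (H x))).
simpl in I; rewrite (Z (x0 + / e)), (Z (x0 - / e)) in I by (field; lra).
now rewrite minus_eq_zero in I.
Qed.

(** * The energy estimate *)

Definition energy_density (r s : R -> R -> R) (e x0 t x : R) : R :=
  cutoff e x0 x ^ 3 * r t x ^ 2 * (r t x - s t x) ^ 2.

Lemma continuity_2d_pt_pow (f : R -> R -> R) (n : nat) (x y : R) :
  continuity_2d_pt f x y -> continuity_2d_pt (fun u v => f u v ^ n) x y.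
Proof.
intros Hf; induction n as [|n IH]; [exact (continuity_2d_pt_const x y 1)|].
now apply (continuity_2d_pt_mult f (fun u v => f u v ^ n)).
Qed.

Lemma continuity_2d_pt_cutoff e x0 t x : continuity_2d_pt (fun _ y => cutoff e x0 y) t x.
Proof.
apply (continuity_1d_2d_pt_comp (cutoff e x0) (fun _ y => y)).
- apply continuity_pt_filterlim.
  exact (is_derive_continuous _ _ _ (is_derive_cutoff e x0 x)).
- apply continuity_2d_pt_id2.
Qed.

Ltac continuous_2d_poly :=
  lazymatch goal with
  | |- continuity_2d_pt (fun u v => @?a u v + @?b u v) _ _ =>
      apply (continuity_2d_pt_plus a b); continuous_2d_poly
  | |- continuity_2d_pt (fun u v => @?a u v - @?b u v) _ _ =>
      apply (continuity_2d_pt_minus a b); continuous_2d_poly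
  | |- continuity_2d_pt (fun u v => @?a u v * @?b u v) _ _ =>
      apply (continuity_2d_pt_mult a b); continuous_2d_poly
  | |- continuity_2d_pt (fun u v => @?a u v ^ ?n) _ _ =>
      apply (continuity_2d_pt_pow a n); continuous_2d_poly
  | |- continuity_2d_pt (fun u v => cutoff _ _ _) _ _ => apply continuity_2d_pt_cutoff
  | |- _ => first [eassumption | apply continuity_2d_pt_const]
  end.

Lemma locally_open_interval (T t : R) : 0 < t < T -> locally t (fun s => 0 < s < T).
Proof.
intros Ht; apply (open_and (fun s => 0 < s) (fun s => s < T)); try easy.
- apply open_gt.
- apply open_lt.
Qed.

Lemma locally_2d_first (P : R -> Prop) (t x : R) :
  locally t P -> locally_2d (fun s _ => P s) t x.
Proof.
intros [d Hd]; exists d; intros s y Hs _; now apply Hd.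
Qed.

Lemma is_derive_energy_density {mu T M r0 r rt r1 r2 r3 s st s1 s2 s3 e x0 t x} :
  0 < t < T ->
  profile mu T M r0 r rt r1 r2 r3 -> profile mu T M r0 s st s1 s2 s3 ->
  is_derive (fun t => energy_density r s e x0 t x) t
    (energy_dt (cutoff e x0 x) (r t x) (s t x) (rt t x) (st t x)).
Proof.
intros Ht Hr Hs.
assert (A := profile_dt Hr t x Ht).
assert (B := profile_dt Hs t x Ht).
unfold energy_density, energy_dt; auto_derive.
- repeat split; eexists; eassumption.
- rewrite (is_derive_unique (fun s : R => r s x) t _ A),
    (is_derive_unique (fun t : R => s t x) t _ B); ring.
Qed.

Definition energy (r s : R -> R -> R) (e x0 t : R) : R :=
  RInt (energy_density r s e x0 t) (x0 - / e) (x0 + / e).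

(** Differentiation under the integral sign, using joint continuity of the time derivatives, zeros
    of [r] included. *)
Lemma is_derive_energy {mu T M r0 r rt r1 r2 r3 s st s1 s2 s3} e x0 t :
  0 < t < T ->
  profile mu T M r0 r rt r1 r2 r3 -> profile mu T M r0 s st s1 s2 s3 ->
  let d := fun x => energy_dt (cutoff e x0 x) (r t x) (s t x) (rt t x) (st t x) in
  ex_RInt d (x0 - / e) (x0 + / e) /\
  is_derive (energy r s e x0) t (RInt d (x0 - / e) (x0 + / e)).
Proof.
intros Ht Hr Hs d.
assert (C : forall t' x, 0 < t' < T -> continuity_2d_pt
  (fun t x => energy_dt (cutoff e x0 x) (r t x) (s t x) (rt t x) (st t x)) t' x).
{ intros t' x Ht'.
  assert (A1 := profile_continuous Hr t' x).
  assert (A2 := profile_continuous Hs t' x).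
  assert (A3 := profile_dt_continuous Hr t' x Ht').
  assert (A4 := profile_dt_continuous Hs t' x Ht').
  unfold energy_dt; continuous_2d_poly. }
split.
- exact (ex_RInt_slice (fun t x =>
    energy_dt (cutoff e x0 x) (r t x) (s t x) (rt t x) (st t x)) t _ _
    (fun x => C t x Ht)).
- assert (U : forall t' x, 0 < t' < T ->
    Derive (fun z => energy_density r s e x0 z x) t' =
    energy_dt (cutoff e x0 x) (r t' x) (s t' x) (rt t' x) (st t' x)).
  { intros t' x Ht'; apply is_derive_unique.
    exact (is_derive_energy_density Ht' Hr Hs). }
  replace (RInt d (x0 - / e) (x0 + / e)) with
    (RInt (fun x => Derive (fun z => energy_density r s e x0 z x) t)
       (x0 - / e) (x0 + / e)) by (apply RInt_ext; intros x _; now apply U).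
  apply (is_derive_RInt_param (energy_density r s e x0)).
  + generalize (locally_open_interval T t Ht); apply filter_imp; intros t' Ht' x _.
    eexists.
    exact (is_derive_energy_density Ht' Hr Hs).
  + intros x _.
    apply continuity_2d_pt_ext_loc with (2 := C t x Ht).
    generalize (locally_2d_first _ t x (locally_open_interval T t Ht)).
    apply locally_2d_impl, locally_2d_forall; intros t' y Ht'.
    now symmetry; apply U.
  + apply filter_forall; intros t'; apply ex_RInt_slice; intros x.
    assert (A1 := profile_continuous Hr t' x).
    assert (A2 := profile_continuous Hs t' x).
    unfold energy_density; continuous_2d_poly.
Qed.

Lemma energy_inequality {mu T M r0 r rt r1 r2 r3 s st s1 s2 s3} x0 :
  0 < T ->
  profile mu T M r0 r rt r1 r2 r3 -> profile mu T M r0 s st s1 s2 s3 ->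
  exists C, 0 <= C /\ forall e t, 0 < e <= 1 -> 0 <= t <= T ->
    energy r s e x0 t <= C * e.
Proof.
intros HT Hr Hs.
(* An index is a triple [(e, t, x)]: graded bounds over all of them give a constant uniform in the
   cutoff width. *)
pose (E := fun i : R * R * R => fst (fst i)).
pose (tau := fun i : R * R * R => snd (fst i)).
pose (xi := fun i : R * R * R => snd i).
pose (g := fun i => cutoff (E i) x0 (xi i)).
pose (D := fun i => 0 < E i <= 1 /\ 0 < tau i < T /\ 0 < r0 (xi i) /\
  Rabs (xi i - x0) <= / E i).
assert (HD : forall i, D i -> 0 < tau i < T /\ 0 < r0 (xi i))
  by (intros i Di; split; apply Di).
assert (Jr := jet_bounds_profile D (fun i => g i + E i) tau xi
    HT HD Hr Hr).
assert (Js := jet_bounds_profile D (fun i => g i + E i) tau xi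
    HT HD Hr Hs).
assert (G : forall i, D i -> 0 < E i <= 1 /\ 0 <= g i <= 1 /\
  Rabs (cutoff' (E i) x0 (xi i)) <= 2 * E i).
{ intros i (He & _ & _ & Hx).
  assert (Hex : Rabs (E i * (xi i - x0)) <= 1).
  { rewrite Rabs_mult, Rabs_pos_eq by lra.
    apply Rmult_le_compat_l with (r := E i) in Hx; [|lra].
    now rewrite Rinv_r in Hx by lra. }
  split; [easy|split].
  - unfold g, cutoff; rewrite <- Rpow_mult_distr.
    assert (X := pow_maj_Rabs _ _ 2 Hex).
    assert (Y := pow2_ge_0 (E i * (xi i - x0))); lra.
  - unfold cutoff'; replace (-2 * E i ^ 2 * (xi i - x0)) with
      (- (2 * E i * (E i * (xi i - x0)))) by ring.
    rewrite Rabs_Ropp, Rabs_mult, Rabs_pos_eq by lra.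
    rewrite <- (Rmult_1_r (2 * E i)) at 2; apply Rmult_le_compat_l; lra. }
assert (Sc : scales D (fun i => r (tau i) (xi i)) (fun i => g i + E i)).
{ exists (M + 2); intros i Di; destruct (G i Di) as (G1 & G2 & _).
  destruct (HD i Di) as [Ht Hx].
  assert (Ht' : 0 <= tau i <= T) by lra.
  assert (P := profile_pos Hr Ht' Hx).
  assert (Q := profile_bounds Hr _ (xi i) Ht'); lra. }
assert (Cu : cutoff_bounds D (fun i => r (tau i) (xi i)) (fun i => g i + E i)
  g (fun i => cutoff' (E i) x0 (xi i)) (fun i => cutoff'' (E i))).
{ split; [|split]; exists 2; intros i Di; destruct (G i Di) as (G1 & G2 & G3);
  simpl powerRZ.
  - rewrite Rabs_pos_eq by lra; lra.
  - lra.
  - unfold cutoff''; rewrite Rabs_left1 by nra; nra. }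
destruct (residue_bound D mu G Sc Cu Jr Js) as [C [C0 HC]].
assert (P1 := exp_pos (C * T)).
(* From Gronwall with source [2 * C * e], the error density [C * e ^ 2] times the length [2 / e] of
   the interval. *)
exists (2 * C * T * exp (C * T)); split.
{ repeat apply Rmult_le_pos; lra. }
intros e t He Ht.
replace (2 * C * T * exp (C * T) * e) with ((2 * C * e) * T * exp (C * T)) by ring.
assert (Ie := Rinv_0_lt_compat e (proj1 He)).
assert (Cd : forall t x, continuity_2d_pt (energy_density r s e x0) t x).
{ intros t' x.
  assert (A1 := profile_continuous Hr t' x).
  assert (A2 := profile_continuous Hs t' x).
  unfold energy_density; continuous_2d_poly. }
apply (gronwall T C (2 * C * e) (energy r s e x0) (fun t => RInt (fun x =>
  energy_dt (cutoff e x0 x) (r t x) (s t x) (rt t x) (st t x)) (x0 - / e) (x0 + / e)));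
  [easy | nra | | | | | easy].
- intros t' Ht'.
  exact (proj2 (is_derive_energy e x0 _ Ht' Hr Hs)).
- intros t' Ht'.
  assert (I1 := proj1 (is_derive_energy e x0 _ Ht' Hr Hs)).
  assert (I2 := is_RInt_flux e x0 _ HT Ht' (proj1 He) Hr Hs).
  simpl in I1.
  match type of I2 with is_RInt ?h _ _ _ => set (phi := h) in I2 end.
  match type of I1 with ex_RInt ?h _ _ => set (d := h) in * end.
  assert (I3 := ex_RInt_slice (energy_density r s e x0) t' (x0 - / e) (x0 + / e)
    (fun x => Cd t' x)).
  (* Subtracting the flux derivative [phi], whose integral is 0, leaves exactly the residue under
     the integral. *)
  assert (E1 : RInt d (x0 - / e) (x0 + / e) =
    RInt (fun x => d x - phi x) (x0 - / e) (x0 + / e)).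
  { assert (E1 := RInt_minus (V := R_CompleteNormedModule) d phi _ _ I1
      (ex_intro _ _ I2)).
    rewrite (is_RInt_unique _ _ _ _ I2) in E1.
    exact (eq_sym (eq_trans E1 (minus_zero_r _))). }
  assert (E2 : C * energy r s e x0 t' + 2 * C * e =
    RInt (fun x => C * energy_density r s e x0 t' x + C * e ^ 2)
      (x0 - / e) (x0 + / e)).
  { rewrite (RInt_plus (V := R_CompleteNormedModule)
      (fun x => C * energy_density r s e x0 t' x) (fun _ => C * e ^ 2)).
    - rewrite (RInt_scal (V := R_CompleteNormedModule)
        (energy_density r s e x0 t') _ _ C) by easy.
      rewrite RInt_const.
      change (C * energy r s e x0 t' + 2 * C * e = C * energy r s e x0 t' +
        (x0 + / e - (x0 - / e)) * (C * e ^ 2)); field; lra.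
    - now apply (ex_RInt_scal (V := R_CompleteNormedModule)).
    - apply ex_RInt_const. }
  rewrite E1, E2; apply RInt_le; [lra| | |].
  + apply (ex_RInt_minus (V := R_CompleteNormedModule)); [easy | now exists 0].
  + apply (ex_RInt_plus (V := R_CompleteNormedModule)
      (fun x => C * energy_density r s e x0 t' x) (fun _ => C * e ^ 2)).
    * now apply (ex_RInt_scal (V := R_CompleteNormedModule)).
    * apply ex_RInt_const.
  + intros x Hx; unfold d, phi.
    match goal with |- ?a - (?a - ?b) <= _ => replace (a - (a - b)) with b by ring end.
    destruct (profile_init_bounds x HT Hr) as [[Px|Px] _].
    * assert (Di : D (e, t', x)).
      { split; [easy|split; [easy|split; [easy|]]].
        change (Rabs (x - x0) <= / e); apply Rabs_le; lra. }
      exact (HC _ Di).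
    (* Zeros of the datum lie outside [D]; there residue and energy density both vanish. *)
    * assert (Ht2 : 0 <= t' <= T) by lra.
      unfold energy_density.
      rewrite (profile_zero Hr Ht2 (eq_sym Px)).
      rewrite (profile_zero Hs Ht2 (eq_sym Px)).
      rewrite residue_zero; assert (Y := pow2_ge_0 e); nra.
- intros t' _; apply continuity_RInt; [lra | apply Cd].
- unfold energy.
  transitivity (RInt (fun _ : R => 0) (x0 - / e) (x0 + / e)).
  + apply RInt_ext; intros x _; unfold energy_density.
    rewrite (profile_init Hr), (profile_init Hs).
    change (cutoff e x0 x ^ 3 * r0 x ^ 2 * (r0 x - r0 x) ^ 2 = 0); ring.
  + rewrite RInt_const; apply Rmult_0_r.
Qed.

(** Centre the cutoff at the point itself. If [r0 x > 0] the weight [r^2] is positive there, so a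
    difference of the solutions would bound the energy below independently of [e], against the bound
    [C * e]. *)
Lemma profile_unique {mu T M r0 r rt r1 r2 r3 s st s1 s2 s3} t x :
  0 < T ->
  profile mu T M r0 r rt r1 r2 r3 -> profile mu T M r0 s st s1 s2 s3 ->
  0 <= t <= T -> r t x = s t x.
Proof.
intros HT Hr Hs Ht.
destruct (profile_init_bounds x HT Hr) as [[Px|Px] _].
2: { rewrite (profile_zero Hr Ht (eq_sym Px)).
  now rewrite (profile_zero Hs Ht (eq_sym Px)). }
destruct (Req_dec (r t x) (s t x)) as [|Hne]; [easy|exfalso].
assert (Pr := profile_pos Hr Ht Px).
set (h := fun y => r t y ^ 2 * (r t y - s t y) ^ 2).
assert (Hh : 0 < h x).
{ unfold h; apply Rmult_lt_0_compat; [now apply pow_lt|].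
  rewrite <- pow2_abs; apply pow_lt, Rabs_pos_lt; lra. }
assert (Ch : continuous h x).
{ assert (A1 := continuous_slice _ _ _ (profile_continuous Hr t x)).
  assert (A2 := continuous_slice _ _ _ (profile_continuous Hs t x)).
  unfold h; continuous_poly. }
assert (Hpos : 0 < h x / 2) by lra.
destruct (Ch (ball (h x) (mkposreal _ Hpos)) (locally_ball _ _)) as [d0 Hd0].
pose (d := Rmin (d0 / 2) (/ 2)).
assert (Hd : 0 < d <= / 2).
{ split; [apply Rmin_pos; assert (X := cond_pos d0); lra | apply Rmin_r]. }
assert (Hd' : d < d0).
{ apply Rle_lt_trans with (1 := Rmin_l _ _); assert (X := cond_pos d0); lra. }
assert (Hb : forall y, x - d < y < x + d -> h x / 2 <= h y).
{ intros y Hy; specialize (Hd0 y).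
  change (Rabs (y - x) < d0 -> Rabs (h y - h x) < h x / 2) in Hd0.
  assert (X := Rabs_def2 _ _ (Hd0 ltac:(apply Rabs_def1; lra))); lra. }
destruct (energy_inequality x HT Hr Hs) as [C [C0 HC]].
assert (Hlow : forall e, 0 < e <= 1 -> d * (h x / 8) <= energy r s e x t).
{ intros e He.
  assert (Ie : 1 <= / e) by (rewrite <- Rinv_1; apply Rinv_le_contravar; lra).
  assert (Cd : forall a b, ex_RInt (energy_density r s e x t) a b).
  { intros a b; apply (ex_RInt_slice (energy_density r s e x)); intros y.
    assert (A1 := profile_continuous Hr t y).
    assert (A2 := profile_continuous Hs t y).
    unfold energy_density; continuous_2d_poly. }
  assert (Cu : forall y, Rabs (y - x) <= / e -> 0 <= cutoff e x y).
  { intros y Hy; unfold cutoff.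
    apply Rmult_le_compat_l with (r := e) in Hy; [|lra].
    rewrite Rinv_r in Hy by lra; rewrite <- (Rabs_pos_eq e) in Hy at 1 by lra.
    rewrite <- Rabs_mult in Hy; rewrite <- Rpow_mult_distr.
    assert (X := pow_maj_Rabs _ _ 2 Hy); lra. }
  assert (Dp : forall y, Rabs (y - x) <= / e -> 0 <= energy_density r s e x t y).
  { intros y Hy; unfold energy_density.
    apply Rmult_le_pos; [apply Rmult_le_pos; [apply pow_le, Cu, Hy|]|];
      apply pow2_ge_0. }
  (* Since [d <= 1/2] and [e <= 1], the cutoff is at least 1/2 here; its cube gives 1/8 and
     continuity of [h] the remaining 1/2. *)
  assert (Dm : forall y, x - d < y < x + d -> h x / 16 <= energy_density r s e x t y).
  { intros y Hy; specialize (Hb y Hy).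
    assert (Cl : / 2 <= cutoff e x y).
    { unfold cutoff; rewrite <- Rpow_mult_distr.
      assert (Y : Rabs (e * (y - x)) <= / 2).
      { rewrite Rabs_mult, Rabs_pos_eq by lra.
        assert (Rabs (y - x) <= / 2) by (apply Rabs_le; lra).
        assert (Z := Rabs_pos (y - x)); nra. }
      assert (X := pow_maj_Rabs _ _ 2 Y); lra. }
    assert (C3 := pow_incr (/ 2) (cutoff e x y) 3 ltac:(lra)).
    unfold energy_density; rewrite Rmult_assoc; fold (h y); nra. }
  assert (Ch1 : energy r s e x t =
    RInt (energy_density r s e x t) (x - / e) (x - d) +
    (RInt (energy_density r s e x t) (x - d) (x + d) +
     RInt (energy_density r s e x t) (x + d) (x + / e))).
  { unfold energy.
    rewrite <- (RInt_Chasles (energy_density r s e x t) (x - / e) (x - d)) by auto.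
    now rewrite <- (RInt_Chasles (energy_density r s e x t) (x - d) (x + d)) by auto. }
  rewrite Ch1.
  assert (B1 : 0 <= RInt (energy_density r s e x t) (x - / e) (x - d)).
  { apply RInt_ge_0; [lra | auto | intros y Hy; apply Dp, Rabs_le; lra]. }
  assert (B2 : 0 <= RInt (energy_density r s e x t) (x + d) (x + / e)).
  { apply RInt_ge_0; [lra | auto | intros y Hy; apply Dp, Rabs_le; lra]. }
  assert (B3 : d * (h x / 8) <= RInt (energy_density r s e x t) (x - d) (x + d)).
  { apply Rle_trans with (RInt (fun _ : R => h x / 16) (x - d) (x + d)).
    - rewrite RInt_const; right.
      change (d * (h x / 8) = (x + d - (x - d)) * (h x / 16)); field.
    - apply RInt_le; [lra | apply ex_RInt_const | auto | exact Dm]. }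
  lra. }
set (L := d * (h x / 8)) in *.
assert (HL : 0 < L) by (unfold L; nra).
(* Chosen so that [C * e < L], contradicting the lower bound [L]. *)
pose (e := Rmin 1 (L / (2 * (C + 1)))).
assert (He : 0 < e <= 1).
{ split; [apply Rmin_pos; [lra | apply Rdiv_lt_0_compat; lra] | apply Rmin_l]. }
assert (He2 : e * (2 * (C + 1)) <= L).
{ apply Rle_trans with (L / (2 * (C + 1)) * (2 * (C + 1))).
  - apply Rmult_le_compat_r; [lra | apply Rmin_r].
  - right; field; lra. }
assert (X := Rle_trans _ _ _ (Hlow e He) (HC e t He Ht)); nra.
Qed.

(** * From hydrodynamic solutions to profiles *)

Lemma nnpow_Rpower (x a : R) : 0 < x -> nnpow x a = Rpower x a.
Proof. intros Hx; unfold nnpow; now destruct (Rlt_dec 0 x). Qed.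

Lemma nnpow_zero (x a : R) : x <= 0 -> nnpow x a = 0.
Proof. intros Hx; unfold nnpow; destruct (Rlt_dec 0 x); lra. Qed.

Lemma nnpow_pos (x a : R) : 0 < x -> 0 < nnpow x a.
Proof. intros Hx; rewrite nnpow_Rpower by easy; apply exp_pos. Qed.

Lemma nnpow_nonneg (x a : R) : 0 <= nnpow x a.
Proof.
destruct (Rlt_le_dec 0 x) as [H|H]; [now apply Rlt_le, nnpow_pos|].
rewrite nnpow_zero; lra.
Qed.

Lemma nnpow_pow (x a : R) (n : nat) :
  (0 < n)%nat -> nnpow x a ^ n = nnpow x (INR n * a).
Proof.
intros Hn; destruct (Rlt_le_dec 0 x) as [H|H].
- rewrite !nnpow_Rpower, <- Rpower_pow by (easy || apply exp_pos).
  now rewrite Rpower_mult, Rmult_comm.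
- rewrite !nnpow_zero by easy; now apply pow_ne_zero; lia.
Qed.

Lemma nnpow_two_thirds_sqr (x : R) : nnpow x (2 / 3) ^ 2 = nnpow x (4 / 3).
Proof. rewrite nnpow_pow by lia; f_equal; simpl; field. Qed.

Lemma nnpow_two_thirds_cube (x : R) : 0 <= x -> nnpow x (2 / 3) ^ 3 = x ^ 2.
Proof.
intros [Hx| <-].
- rewrite nnpow_pow by lia; replace (INR 3 * (2 / 3)) with (INR 2) by (simpl; field).
  rewrite nnpow_Rpower by easy; now apply Rpower_pow.
- rewrite nnpow_zero by lra; ring.
Qed.

Lemma cube_le_reg (a b : R) : 0 <= b -> a ^ 3 <= b ^ 3 -> a <= b.
Proof.
intros Hb H; destruct (Rle_lt_dec a b) as [|Hlt]; [easy|exfalso].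
assert (b ^ 3 < a ^ 3); [|lra].
assert (b ^ 2 <= a ^ 2) by (apply pow_incr; lra).
assert (0 <= b ^ 2) by apply pow2_ge_0.
change (b * b ^ 2 < a * a ^ 2).
assert (0 < a ^ 2) by (apply pow_lt; lra); nra.
Qed.

Lemma continuity_pt_nnpow_two_thirds (x : R) :
  0 <= x -> continuity_pt (fun y => nnpow y (2 / 3)) x.
Proof.
intros [Hx| <-].
- apply continuity_pt_filterlim.
  cut (continuous (fun y => nnpow y (2 / 3)) x); [easy|].
  apply (continuous_ext_loc _ (fun y => Rpower y (2 / 3))).
  + generalize (open_gt 0 x Hx); apply filter_imp; intros y Hy.
    now rewrite nnpow_Rpower.
  + apply (ex_derive_continuous (K := R_AbsRing) (V := R_NormedModule)).
    unfold Rpower; auto_derive; easy.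
- intros eps Heps.
  assert (H3 : 0 < eps ^ 3) by (now apply pow_lt).
  (* If [y^(2/3) >= eps], then [y^2 >= eps^3], whereas [y < 1] gives [y^2 <= y < eps^3]. *)
  exists (Rmin 1 (eps ^ 3)); split; [apply Rmin_pos; lra|].
  intros y [_ Hy]; simpl in *; unfold R_dist in *.
  rewrite (nnpow_zero 0), Rminus_0_r by lra; rewrite Rminus_0_r in Hy.
  rewrite Rabs_pos_eq by apply nnpow_nonneg.
  destruct (Rlt_le_dec 0 y) as [Py|Py]; [|now rewrite nnpow_zero].
  rewrite Rabs_pos_eq in Hy by lra.
  assert (Y1 := Rlt_le_trans _ _ _ Hy (Rmin_l _ _)).
  assert (Y2 := Rlt_le_trans _ _ _ Hy (Rmin_r _ _)).
  destruct (Rlt_le_dec (nnpow y (2 / 3)) eps) as [|Hle]; [easy|exfalso].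
  assert (X := pow_incr eps _ 3 (conj (Rlt_le _ _ Heps) Hle)).
  rewrite nnpow_two_thirds_cube in X by lra; nra.
Qed.

(** * Extension in time beyond [[0, T]] *)

(** Solutions are constrained only on [[0, T]]. Freezing time outside turns one-sided continuity at
    the endpoints into ordinary continuity on the plane. *)
Definition clamp (T t : R) : R := Rmax 0 (Rmin t T).

Lemma clamp_in (T t : R) : 0 < T -> 0 <= clamp T t <= T.
Proof.
intros HT; unfold clamp; split; [apply Rmax_l|].
apply Rmax_lub; [lra | apply Rmin_r].
Qed.

Lemma clamp_id (T t : R) : 0 <= t <= T -> clamp T t = t.
Proof. intros Ht; unfold clamp; rewrite Rmin_left, Rmax_right; lra. Qed.

Lemma clamp_lipschitz (T s t : R) : Rabs (clamp T s - clamp T t) <= Rabs (s - t).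
Proof.
unfold clamp, Rmax, Rmin.
destruct (Rle_dec s T), (Rle_dec t T);
  repeat match goal with |- context [Rle_dec ?a ?b] => destruct (Rle_dec a b) end;
  unfold Rabs; repeat match goal with |- context [Rcase_abs ?a] => destruct (Rcase_abs a) end;
  lra.
Qed.

Lemma continuity_2d_pt_clamp (T : R) (f : R -> R -> R) (t x : R) :
  0 < T -> continuous_strip T f -> continuity_2d_pt (fun t x => f (clamp T t) x) t x.
Proof.
intros HT Hf eps.
destruct (Hf (clamp T t) x (clamp_in T t HT) _ (locally_ball _ eps)) as [d Hd].
exists d; intros s y Hs Hy.
apply (Hd (clamp T s, y)).
- split; [|exact Hy].
  exact (Rle_lt_trans _ _ _ (clamp_lipschitz T s t) Hs).
- now apply clamp_in.
Qed.

Lemma at_time_locally (T t : R) (P : R -> Prop) :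
  0 < t < T -> at_time T t P -> locally t P.
Proof.
intros Ht HP; unfold at_time, within in HP.
generalize (filter_and _ _ HP (locally_open_interval T t Ht)).
apply filter_imp; intros s [H1 H2]; apply H1; lra.
Qed.

Lemma is_dt_interior (T : R) (f : R -> R -> R) (t x l : R) :
  0 < t < T -> is_dt T f t x l -> is_derive (fun s => f s x) t l.
Proof.
intros Ht [Hl H]; split; [exact Hl|].
intros y Hy eps; apply (at_time_locally T t _ Ht), H.
intros P HP; unfold at_time, within.
generalize (Hy P HP); apply filter_imp; auto.
Qed.

(** * Uniform bounds from the norms *)

Lemma Ck_derive_n (k n : nat) (f : R -> R) (x : R) :
  Ck k f -> (n < k)%nat -> is_derive (Derive_n f n) x (Derive_n f (S n) x).
Proof.
intros Hf Hn; apply Derive_correct; exact (proj1 (Hf (S n) x Hn)).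
Qed.

Lemma Derive_n_minus_Ck (k n : nat) (f g : R -> R) (x : R) :
  Ck k f -> Ck k g -> (n <= k)%nat ->
  Derive_n (fun y => f y - g y) n x = Derive_n f n x - Derive_n g n x.
Proof.
intros Hf Hg Hn; apply Derive_n_minus; apply filter_forall; intros y m Hm;
  [apply Hf | apply Hg]; lia.
Qed.

(** The bound excludes [p_infty] and the value at a point excludes [m_infty], so [real] loses
    nothing. *)
Lemma supnorm_spec (f : R -> R) (B : R) :
  (forall x, Rabs (f x) <= B) ->
  (forall x, Rabs (f x) <= real (supnorm f)) /\ real (supnorm f) <= B.
Proof.
intros HB; unfold supnorm.
destruct (Lub_Rbar_correct (fun y => exists x, y = Rabs (f x))) as [Hu Hl].
assert (H1 := fun x => Hu _ (ex_intro _ x eq_refl)).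
assert (H2 : Rbar_le (Lub_Rbar (fun y => exists x, y = Rabs (f x))) (Finite B)).
{ apply Hl; intros y [x ->]; apply HB. }
destruct (Lub_Rbar (fun y => exists x, y = Rabs (f x))) as [l| |]; simpl in *.
- now split.
- easy.
- now destruct (H1 0).
Qed.

Lemma term_le_sum (a : nat -> R) (k n : nat) :
  (forall m, (m <= k)%nat -> 0 <= a m) -> (n <= k)%nat -> a n <= sum_f_R0 a k.
Proof.
intros Ha; revert n; induction k as [|k IH]; intros n Hn.
- replace n with 0%nat by lia; apply Rle_refl.
- rewrite tech5; assert (IH' := IH (fun m Hm => Ha m ltac:(lia))).
  assert (H1 := Ha (S k) (le_n _)).
  destruct (Nat.eq_dec n (S k)) as [->|Hne].
  + assert (H0 := Ha 0%nat ltac:(lia)); assert (H2 := IH' 0%nat ltac:(lia)); lra.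
  + assert (H2 := IH' n ltac:(lia)); lra.
Qed.

Lemma Derive_n_le_Wnorm (k n : nat) (f : R -> R) (x : R) :
  (forall m, (m <= k)%nat -> exists M, forall y, Rabs (Derive_n f m y) <= M) ->
  (n <= k)%nat -> Rabs (Derive_n f n x) <= Wnorm k f.
Proof.
intros Hf Hn.
assert (S0 : forall m, (m <= k)%nat ->
  forall y, Rabs (Derive_n f m y) <= real (supnorm (Derive_n f m))).
{ intros m Hm; destruct (Hf m Hm) as [M HM]; apply (supnorm_spec _ _ HM). }
apply Rle_trans with (1 := S0 n Hn x).
apply (term_le_sum (fun n => real (supnorm (Derive_n f n)))); [|easy].
intros m Hm; apply Rle_trans with (2 := S0 m Hm 0), Rabs_pos.
Qed.

Lemma Derive_n_dist_le_Wnorm (k n : nat) (f g : R -> R) (x : R) :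
  Ckb k f -> Ckb k g -> (n <= k)%nat ->
  Rabs (Derive_n f n x - Derive_n g n x) <= Wnorm k (fun y => f y - g y).
Proof.
intros [Hf Bf] [Hg Bg] Hn.
rewrite <- (Derive_n_minus_Ck k) by easy.
apply Derive_n_le_Wnorm; [|easy]; intros m Hm.
destruct (Bf m Hm) as [Mf HMf], (Bg m Hm) as [Mg HMg].
exists (Mf + Mg); intros y; rewrite (Derive_n_minus_Ck k) by easy.
apply Rle_trans with (1 := Rabs_triang _ _); rewrite Rabs_Ropp.
specialize (HMf y); specialize (HMg y); lra.
Qed.

(** The supremum [N t] of the derivative changes by at most the [Wnorm] of the difference, so it is
    continuous in time, hence bounded on the compact [[0, T]]. *)
Lemma C_Ckb_uniform_bound (T : R) (k n : nat) (v : R -> R -> R) :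
  0 < T -> C_Ckb T k v -> (n <= k)%nat ->
  exists M, forall t x, 0 <= t <= T -> Rabs (Derive_n (v t) n x) <= M.
Proof.
intros HT Hv Hn.
set (N := fun t => real (supnorm (Derive_n (v (clamp T t)) n))).
assert (HN : forall t, (forall x, Rabs (Derive_n (v (clamp T t)) n x) <= N t) /\
  forall B, (forall x, Rabs (Derive_n (v (clamp T t)) n x) <= B) -> N t <= B).
{ intros t; destruct (Hv _ (clamp_in T t HT)) as [[_ Hb] _].
  destruct (Hb n Hn) as [M HM]; split; [apply (supnorm_spec _ _ HM)|].
  intros B HB; apply (supnorm_spec _ _ HB). }
destruct (bounded_continuity (K := R_AbsRing) (V := R_NormedModule) N 0 T) as [M HM].
- intros t Ht P [eps HP].
  destruct (proj2 (Hv t Ht) _ (locally_ball 0 eps)) as [d Hd].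
  exists d; intros s Hs; apply HP.
  assert (Hc := clamp_in T s HT).
  assert (Hs' : Rabs (clamp T s - t) < d).
  { rewrite <- (clamp_id T t Ht) at 1.
    exact (Rle_lt_trans _ _ _ (clamp_lipschitz T s t) Hs). }
  specialize (Hd _ Hs' Hc); change (Rabs (Wnorm k (fun x => v (clamp T s) x - v t x) - 0) < eps) in Hd.
  rewrite Rminus_0_r in Hd; apply Rabs_def2 in Hd.
  assert (W := fun x => Derive_n_dist_le_Wnorm k n (v (clamp T s)) (v t) x
    (proj1 (Hv _ Hc)) (proj1 (Hv _ Ht)) Hn).
  destruct (HN s) as [S1 S2], (HN t) as [T1 T2].
  rewrite clamp_id in T1, T2 by easy.
  set (w := Wnorm k _) in *.
  assert (N s <= N t + w).
  { apply S2; intros x; specialize (W x); specialize (T1 x).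
    assert (X := Rabs_triang (Derive_n (v (clamp T s)) n x - Derive_n (v t) n x)
      (Derive_n (v t) n x)).
    replace (Derive_n (v (clamp T s)) n x - Derive_n (v t) n x + Derive_n (v t) n x)
      with (Derive_n (v (clamp T s)) n x) in X by ring; lra. }
  assert (N t <= N s + w).
  { apply T2; intros x; specialize (W x); specialize (S1 x).
    rewrite Rabs_minus_sym in W.
    assert (X := Rabs_triang (Derive_n (v t) n x - Derive_n (v (clamp T s)) n x)
      (Derive_n (v (clamp T s)) n x)).
    replace (Derive_n (v t) n x - Derive_n (v (clamp T s)) n x
      + Derive_n (v (clamp T s)) n x) with (Derive_n (v t) n x) in X by ring; lra. }
  change (Rabs (N s - N t) < eps); apply Rabs_def1; lra.
- exists M; intros t x Ht; specialize (HM t Ht).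
  destruct (HN t) as [T1 _]; rewrite clamp_id in T1 by easy.
  apply Rle_trans with (1 := T1 x).
  apply Rle_trans with (1 := Rle_abs _); now apply Rlt_le.
Qed.

(** * Spatial derivatives of [u^(2/3)] *)

Lemma quadratic_upper_bound (f : R -> R) (M x h : R) :
  Ck 2 f -> (forall y, Rabs (Derive_n f 2 y) <= M) ->
  f (x + h) <= f x + Derive_n f 1 x * h + M * h ^ 2.
Proof.
intros Hf HM.
assert (M0 : 0 <= M) by (apply Rle_trans with (2 := HM 0), Rabs_pos).
assert (D0 : forall y, is_derive f y (Derive_n f 1 y))
  by (intros y; apply (Ck_derive_n 2 0); [easy | lia]).
assert (D1 : forall y, is_derive (Derive_n f 1) y (Derive_n f 2 y))
  by (intros y; apply (Ck_derive_n 2 1); [easy | lia]).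
destruct (MVT_gen f x (x + h) (Derive_n f 1)) as [c [Hc Ec]]; [auto| |].
{ intros y _; apply continuity_pt_filterlim.
  exact (is_derive_continuous _ _ _ (D0 y)). }
destruct (MVT_gen (Derive_n f 1) x c (Derive_n f 2)) as [c' [Hc' Ec']]; [auto| |].
{ intros y _; apply continuity_pt_filterlim.
  exact (is_derive_continuous _ _ _ (D1 y)). }
replace (f (x + h)) with (f x + (f (x + h) - f x)) by ring; rewrite Ec.
replace (Derive_n f 1 c) with (Derive_n f 1 x + (Derive_n f 1 c - Derive_n f 1 x)) by ring.
rewrite Ec'.
assert (Hxc : Rabs (c - x) <= Rabs h).
{ unfold Rmin, Rmax in Hc; destruct (Rle_dec x (x + h));
  unfold Rabs; destruct (Rcase_abs (c - x)), (Rcase_abs h); lra. }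
assert (X : Rabs (Derive_n f 2 c' * ((c - x) * h)) <= M * (Rabs h * Rabs h)).
{ rewrite !Rabs_mult; apply Rmult_le_compat; [apply Rabs_pos | | apply HM|].
  - apply Rmult_le_pos; apply Rabs_pos.
  - apply Rmult_le_compat_r; [apply Rabs_pos | easy]. }
replace (Rabs h * Rabs h) with (h ^ 2) in X by (rewrite <- pow2_abs; ring).
assert (Y := Rle_trans _ _ _ (Rle_abs _) X); lra.
Qed.

(** Glaeser's inequality: the quadratic upper bound must stay nonnegative at its minimum
    [h = - f' / (2 M)]. The factor 4 instead of 2 comes from the remainder [M * h ^ 2]. *)
Lemma derive_sqr_le_of_nonneg (f : R -> R) (M x : R) :
  0 < M -> Ck 2 f -> (forall y, 0 <= f y) -> (forall y, Rabs (Derive_n f 2 y) <= M) ->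
  Derive_n f 1 x ^ 2 <= 4 * M * f x.
Proof.
intros M0 Hf H0 HM.
assert (H := quadratic_upper_bound f M x (- Derive_n f 1 x / (2 * M)) Hf HM).
assert (P := Rle_trans _ _ _ (H0 _) H).
apply Rmult_le_compat_l with (r := 4 * M) in P; [|lra].
replace (4 * M * (_ + _ + _)) with (4 * M * f x - Derive_n f 1 x ^ 2) in P by (field; lra).
lra.
Qed.

Definition rad (q : R -> R) (x : R) : R := nnpow (q x) (2 / 3).

(* The jet of [rad q], from differentiating [rad q ^ 3 = q ^ 2]. *)
Definition rad1 (q : R -> R) (x : R) : R :=
  Derive_n (fun y => q y ^ 2) 1 x / (3 * rad q x ^ 2).
Definition rad2 (q : R -> R) (x : R) : R :=
  (Derive_n (fun y => q y ^ 2) 2 x - 6 * rad q x * rad1 q x ^ 2) / (3 * rad q x ^ 2).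
Definition rad3 (q : R -> R) (x : R) : R :=
  (Derive_n (fun y => q y ^ 2) 3 x - 18 * rad q x * rad1 q x * rad2 q x
   - 6 * rad1 q x ^ 3) / (3 * rad q x ^ 2).

Lemma rad_pos (q : R -> R) (x : R) : 0 < q x -> 0 < rad q x.
Proof. apply nnpow_pos. Qed.

Lemma rad_cube (q : R -> R) (x : R) : 0 <= q x -> rad q x ^ 3 = q x ^ 2.
Proof. apply nnpow_two_thirds_cube. Qed.

(** The smoothness assumed is that of [q ^ 2], so near [x] the function is written as the cube root
    of [q ^ 2], through [exp] and [ln]. *)
Lemma is_derive_rad (q : R -> R) (x : R) :
  Ck 3 (fun y => q y ^ 2) -> continuous q x -> 0 < q x ->
  is_derive (rad q) x (rad1 q x).
Proof.
intros HG Hc Hx.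
assert (HGd := Ck_derive_n 3 0 _ x HG ltac:(lia)); change (Derive_n (fun y => q y ^ 2) 0)
  with (fun y => q y ^ 2) in HGd.
apply (is_derive_ext_loc (fun y => exp (/ 3 * ln (q y ^ 2)))).
- apply (filter_imp (fun y => 0 < q y)); [intros y Hy | exact (Hc _ (open_gt 0 (q x) Hx))].
  unfold rad; rewrite nnpow_Rpower by easy; unfold Rpower.
  rewrite ln_pow by easy; f_equal; simpl; field.
- assert (Hr := rad_pos q x Hx).
  assert (E : exp (/ 3 * ln (q x ^ 2)) = rad q x).
  { unfold rad; rewrite nnpow_Rpower by easy; unfold Rpower.
    rewrite ln_pow by easy; f_equal; simpl; field. }
  assert (E3 := rad_cube q x (Rlt_le _ _ Hx)).
  assert (P : 0 < q x ^ 2) by (now apply pow_lt).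
  assert (A := is_derive_comp (fun g => exp (/ 3 * ln g)) (fun y => q y ^ 2) x
    (/ 3 * / (q x ^ 2) * exp (/ 3 * ln (q x ^ 2))) _
    ltac:(auto_derive; [easy | ring]) HGd).
  match type of A with is_derive _ _ ?l => replace (rad1 q x) with l; [exact A|] end.
  rewrite E, <- E3.
  change (Derive_n (fun y => q y ^ 2) 1 x * (/ 3 * / rad q x ^ 3 * rad q x) = rad1 q x).
  unfold rad1; field; lra.
Qed.

(** The quotient reappears inside its own derivative, which is the recursive shape of [rad2] and
    [rad3]. *)
Lemma is_derive_quotient (a r : R -> R) (x a' r' : R) :
  is_derive a x a' -> is_derive r x r' -> 0 < r x ->
  is_derive (fun y => a y / (3 * r y ^ 2)) x
    ((a' - 6 * r x * r' * (a x / (3 * r x ^ 2))) / (3 * r x ^ 2)).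
Proof.
intros Ha Hr P; auto_derive.
- repeat split; try (eexists; eassumption).
  apply Rmult_integral_contrapositive_currified; [lra|].
  apply Rmult_integral_contrapositive_currified; lra.
- change (Derive (fun x => a x) x) with (Derive a x).
  change (Derive (fun x => r x) x) with (Derive r x).
  rewrite (is_derive_unique _ _ _ Ha), (is_derive_unique _ _ _ Hr); field; lra.
Qed.

Lemma is_derive_rad1 (q : R -> R) (x : R) :
  Ck 3 (fun y => q y ^ 2) -> continuous q x -> 0 < q x ->
  is_derive (rad1 q) x (rad2 q x).
Proof.
intros HG Hc Hx.
assert (D := is_derive_quotient _ _ _ _ _ (Ck_derive_n 3 1 _ x HG ltac:(lia))
  (is_derive_rad q x HG Hc Hx) (rad_pos q x Hx)).
fold (rad1 q x) in D.
unfold rad2; replace (6 * rad q x * rad1 q x ^ 2) with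
  (6 * rad q x * rad1 q x * rad1 q x) by ring; exact D.
Qed.

Lemma is_derive_rad2 (q : R -> R) (x : R) :
  Ck 3 (fun y => q y ^ 2) -> continuous q x -> 0 < q x ->
  is_derive (rad2 q) x (rad3 q x).
Proof.
intros HG Hc Hx.
assert (D0 := is_derive_rad q x HG Hc Hx).
assert (D1 := is_derive_rad1 q x HG Hc Hx).
assert (D2 := Ck_derive_n 3 2 _ x HG ltac:(lia)).
assert (N : is_derive (fun y => 6 * rad q y * rad1 q y ^ 2) x
  (6 * rad1 q x ^ 3 + 12 * rad q x * rad1 q x * rad2 q x)).
{ revert D0 D1; generalize (rad q) (rad1 q) (rad2 q x); intros f g g' D0 D1.
  auto_derive; [repeat split; eexists; eassumption|].
  change (Derive (fun x => f x) x) with (Derive f x).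
  change (Derive (fun x => g x) x) with (Derive g x).
  rewrite (is_derive_unique _ _ _ D0), (is_derive_unique _ _ _ D1); ring. }
assert (D := is_derive_quotient _ _ _ _ _
  (is_derive_minus _ _ _ _ _ D2 N) D0 (rad_pos q x Hx)).
simpl in D; fold (rad2 q x) in D.
match type of D with is_derive _ _ ?l => replace (rad3 q x) with l; [exact D|] end.
unfold rad3; f_equal.
change (Derive_n (fun y => q y ^ 2) 3 x
  - (6 * rad1 q x ^ 3 + 12 * rad q x * rad1 q x * rad2 q x)
  - 6 * rad q x * rad1 q x * rad2 q x =
  Derive_n (fun y => q y ^ 2) 3 x - 18 * rad q x * rad1 q x * rad2 q x
   - 6 * rad1 q x ^ 3); ring.
Qed.

Lemma continuous_rad3 (q : R -> R) (x : R) :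
  Ck 3 (fun y => q y ^ 2) -> continuous q x -> 0 < q x -> continuous (rad3 q) x.
Proof.
intros HG Hc Hx.
assert (D0 := is_derive_continuous _ _ _ (is_derive_rad q x HG Hc Hx)).
assert (D1 := is_derive_continuous _ _ _ (is_derive_rad1 q x HG Hc Hx)).
assert (D2 := is_derive_continuous _ _ _ (is_derive_rad2 q x HG Hc Hx)).
assert (D3 := proj2 (HG 3%nat x ltac:(lia))).
assert (P := rad_pos q x Hx).
apply (continuous_mult (K := R_AbsRing)
  (fun x => Derive_n (fun y => q y ^ 2) 3 x - 18 * rad q x * rad1 q x * rad2 q x
   - 6 * rad1 q x ^ 3) (fun x => / (3 * rad q x ^ 2))).
- revert D3; generalize (Derive_n (fun y => q y ^ 2) 3); intros g Hg; continuous_poly.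
- apply continuous_Rinv_comp; [continuous_poly|].
  apply Rmult_integral_contrapositive_currified; [lra | apply pow_nonzero; lra].
Qed.

(** With [F = r^2] and [G = r^3]: Glaeser's inequality for [F] reads [4 r^2 r_x^2 <= 4 M r^2] and
    bounds [r_x]; then [F'' = 2 r_x^2 + 2 r r_xx] bounds [r r_xx], and [G'''] bounds [r^2 r_xxx]. *)
Lemma rad_jet_bounds (q : R -> R) (M x : R) :
  1 <= M ->
  Ck 3 (fun y => q y ^ 2) -> (forall y, Rabs (Derive_n (fun y => q y ^ 2) 3 y) <= M) ->
  Ck 2 (fun y => nnpow (q y) (4 / 3)) ->
  (forall y, Rabs (Derive_n (fun y => nnpow (q y) (4 / 3)) 2 y) <= M) ->
  (forall y, continuous q y) -> 0 < q x ->
  Rabs (rad1 q x) <= M /\ Rabs (rad q x * rad2 q x) <= 2 * M ^ 2 /\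
  Rabs (rad q x ^ 2 * rad3 q x) <= 15 * M ^ 3.
Proof.
intros HM HG BG HF BF Hc Hx.
assert (P := rad_pos q x Hx).
set (F := fun y => nnpow (q y) (4 / 3)) in *.
assert (F1 : forall y, 0 < q y -> Derive_n F 1 y = 2 * rad q y * rad1 q y).
{ intros y Hy; apply is_derive_unique.
  apply (is_derive_ext (fun y => rad q y ^ 2)).
  - intros z; apply nnpow_two_thirds_sqr.
  - assert (D0 := is_derive_rad q y HG (Hc y) Hy).
    revert D0; generalize (rad q) (rad1 q y); intros f g D0.
    auto_derive; [eexists; eassumption|].
    change (Derive (fun x => f x) y) with (Derive f y).
    rewrite (is_derive_unique _ _ _ D0); ring. }
assert (F2 : Derive_n F 2 x = 2 * rad1 q x ^ 2 + 2 * (rad q x * rad2 q x)).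
{ apply is_derive_unique.
  apply (is_derive_ext_loc (fun y => 2 * rad q y * rad1 q y)).
  - apply (filter_imp (fun y => 0 < q y)).
    + intros y Hy; symmetry; now apply F1.
    + exact (Hc x _ (open_gt 0 (q x) Hx)).
  - assert (D0 := is_derive_rad q x HG (Hc x) Hx).
    assert (D1 := is_derive_rad1 q x HG (Hc x) Hx).
    revert D0 D1; generalize (rad q) (rad1 q) (rad2 q x); intros f g g' D0 D1.
    auto_derive; [repeat split; eexists; eassumption|].
    change (Derive (fun x => f x) x) with (Derive f x).
    change (Derive (fun x => g x) x) with (Derive g x).
    rewrite (is_derive_unique _ _ _ D0), (is_derive_unique _ _ _ D1); ring. }
assert (B1 : rad1 q x ^ 2 <= M).
{ assert (H := derive_sqr_le_of_nonneg F M x ltac:(lra) HF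
    (fun y => nnpow_nonneg _ _) BF).
  unfold F at 2 in H; rewrite F1, <- nnpow_two_thirds_sqr in H by easy.
  fold (rad q x) in H.
  assert (P2 : 0 < 4 * rad q x ^ 2) by (apply Rmult_lt_0_compat; [lra | now apply pow_lt]).
  apply Rmult_le_reg_l with (1 := P2); lra. }
assert (A1 : Rabs (rad1 q x) <= M).
{ rewrite <- (Rabs_pos_eq M) by lra; apply Rsqr_le_abs_0; unfold Rsqr; nra. }
specialize (BF x); rewrite F2 in BF; apply Rabs_le_between in BF.
assert (S := pow2_ge_0 (rad1 q x)).
assert (A2 : Rabs (rad q x * rad2 q x) <= 2 * M ^ 2) by (apply Rabs_le; nra).
split; [easy|split; [easy|]].
specialize (BG x).
(* The three terms are at most [M / 3], [12 M^3] and [2 M^3], together below [15 M^3]. *)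
replace (rad q x ^ 2 * rad3 q x) with
  (/ 3 * Derive_n (fun y => q y ^ 2) 3 x + - (6 * (rad1 q x * (rad q x * rad2 q x)))
   + - (2 * rad1 q x ^ 3)) by (unfold rad3; field; lra).
assert (A3 : Rabs (rad1 q x ^ 3) <= M ^ 3).
{ rewrite <- RPow_abs; apply pow_incr; split; [apply Rabs_pos | easy]. }
assert (A4 : Rabs (rad1 q x * (rad q x * rad2 q x)) <= M * (2 * M ^ 2)).
{ rewrite Rabs_mult; apply Rmult_le_compat; try apply Rabs_pos; easy. }
eapply Rle_trans; [apply Rabs_triang|].
eapply Rle_trans; [apply Rplus_le_compat_r, Rabs_triang|].
rewrite !Rabs_Ropp, !Rabs_mult, (Rabs_pos_eq (/ 3)), (Rabs_pos_eq 6), (Rabs_pos_eq 2) by lra.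
rewrite Rabs_mult in A4.
assert (M <= M ^ 3) by nra.
assert (Z : Rabs (rad1 q x) * (Rabs (rad q x) * Rabs (rad2 q x)) <= M * (2 * M ^ 2))
  by (rewrite <- (Rabs_mult (rad q x)); exact A4).
nra.
Qed.

(** * Evolution in time and construction of the profile *)

(** After factoring out [r], the four terms contribute [38 = 15 + 15 + 5 + 3]. *)
Lemma profile_rhs_bound (mu M r r1 r2 r3 : R) :
  1 <= M -> Rabs mu <= 1 -> 0 <= r <= M -> Rabs r1 <= M ->
  Rabs (r * r2) <= 2 * M ^ 2 -> Rabs (r ^ 2 * r3) <= 15 * M ^ 3 ->
  Rabs (profile_rhs mu r r1 r2 r3) <= 38 * M ^ 3 * r.
Proof.
intros HM Hmu Hr H1 H2 H3.
replace (profile_rhs mu r r1 r2 r3) with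
  (r * - (r ^ 2 * r3 + 15 / 2 * (r1 * (r * r2)) + 5 * r1 ^ 3 + 3 * (mu * (r ^ 2 * r1))))
  by (unfold profile_rhs; field).
rewrite Rabs_mult, (Rabs_pos_eq r), Rmult_comm, Rabs_Ropp by lra.
apply Rmult_le_compat_r; [lra|].
assert (A3 : Rabs (r1 ^ 3) <= M ^ 3).
{ rewrite <- RPow_abs; apply pow_incr; split; [apply Rabs_pos | easy]. }
assert (A4 : Rabs (r1 * (r * r2)) <= M * (2 * M ^ 2)).
{ rewrite Rabs_mult; apply Rmult_le_compat; try apply Rabs_pos; easy. }
assert (A5 : Rabs (mu * (r ^ 2 * r1)) <= 1 * (M ^ 2 * M)).
{ rewrite Rabs_mult; apply Rmult_le_compat; try apply Rabs_pos; [easy|].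
  rewrite Rabs_mult; apply Rmult_le_compat; try apply Rabs_pos; [|easy].
  rewrite Rabs_pos_eq by apply pow2_ge_0; now apply pow_incr. }
apply Rabs_le_between in A3, A4, A5, H3; apply Rabs_le.
assert (0 <= M ^ 3) by (apply pow_le; lra).
replace (M * (2 * M ^ 2)) with (2 * M ^ 3) in A4 by ring.
replace (1 * (M ^ 2 * M)) with (M ^ 3) in A5 by ring.
lra.
Qed.

(* [ux] and the derivatives [G1, G2, G3] of [u ^ 2] are eliminated through
   [u ^ 2 = r ^ 3]. *)
Lemma hydrodynamic_to_profile (mu u ux r r1 r2 r3 G1 G2 G3 : R) :
  0 < u -> 0 < r -> r ^ 3 = u ^ 2 -> 2 * u * ux = G1 ->
  G1 = 3 * r ^ 2 * r1 -> G2 = 3 * r ^ 2 * r2 + 6 * r * r1 ^ 2 ->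
  G3 = 3 * r ^ 2 * r3 + 18 * r * r1 * r2 + 6 * r1 ^ 3 ->
  2 / 3 * (r / u) *
    - ((/ 2 * G3 + mu * G1) * u + (/ 2 * G2 + mu * u ^ 2) * ux) =
  profile_rhs mu r r1 r2 r3.
Proof.
intros Hu Hr E E1 -> -> ->.
assert (Eu : ux = 3 / 2 * (u / r) * r1).
{ apply Rmult_eq_reg_l with (2 * u); [|lra]; rewrite E1.
  replace (2 * u * (3 / 2 * (u / r) * r1)) with (3 * (u ^ 2 / r) * r1) by (field; lra).
  rewrite <- E; field; lra. }
rewrite Eu, <- E; unfold profile_rhs; field; lra.
Qed.

Lemma derive_zero_of_minimum (f : R -> R) (T t l : R) :
  0 < t < T -> (forall s, 0 < s < T -> f t <= f s) -> is_derive f t l -> l = 0.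
Proof.
intros Ht Hm Hd; apply is_derive_Reals in Hd.
assert (X := deriv_minimum f 0 T t (exist _ l Hd) (proj1 Ht) (proj2 Ht)
  (fun s H1 H2 => Hm s (conj H1 H2))).
exact X.
Qed.

(** Both [exp (- C t) f] and [- exp (C t) f] are nonincreasing. Nothing is divided by [f], so zeros
    are allowed and are seen to persist in both directions of time. *)
Lemma exp_comparison (T C : R) (f f' : R -> R) :
  (forall t, 0 < t < T -> is_derive f t (f' t)) ->
  (forall t, 0 < t < T -> Rabs (f' t) <= C * f t) ->
  (forall t, 0 <= t <= T -> continuity_pt f t) ->
  0 <= C -> (forall t, 0 <= t <= T -> 0 <= f t) ->
  forall t, 0 <= t <= T -> f t <= exp (C * T) * f 0 /\ f 0 <= exp (C * T) * f t.
Proof.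
intros Hd Hb Hc HC Hp t Ht.
assert (P : forall c t, exp (- (c * t)) * exp (c * t) = 1).
{ intros c x; rewrite <- exp_plus, Rplus_opp_l; apply exp_0. }
assert (D : forall c t, 0 < t < T ->
  is_derive (fun t => exp (c * t) * f t) t (exp (c * t) * (f' t + c * f t))).
{ intros c x Hx; auto_derive; [eexists; now apply Hd|].
  change (Derive (fun x => f x) x) with (Derive f x).
  rewrite (is_derive_unique _ _ _ (Hd x Hx)); ring. }
assert (Cn : forall c t, 0 <= t <= T -> continuity_pt (fun t => exp (c * t) * f t) t).
{ intros c x Hx; apply continuity_pt_mult; [|now apply Hc].
  apply continuity_pt_filterlim.
  apply (ex_derive_continuous (fun t => exp (c * t))); auto_derive; easy. }
assert (Ht0 : exp (C * t) <= exp (C * T)) by (apply exp_le; nra).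
assert (E1 := exp_pos (C * t)).
split.
- assert (H := nonincreasing_of_derive T _ _ (D (- C))
    ltac:(intros x Hx; specialize (Hb x Hx); apply Rabs_le_between in Hb;
          assert (Q := exp_pos (- C * x)); nra) (Cn (- C)) t Ht).
  simpl in H; rewrite Rmult_0_r, exp_0, Rmult_1_l in H.
  assert (F : f t <= exp (C * t) * f 0).
  { apply Rmult_le_compat_l with (r := exp (C * t)) in H; [|lra].
    rewrite <- Rmult_assoc in H; replace (- C * t) with (- (C * t)) in H by ring.
    rewrite (Rmult_comm (exp (C * t)) (exp _)), P in H; lra. }
  assert (P0 := Hp 0 ltac:(lra)); nra.
- assert (H := nonincreasing_of_derive T _ _
    (fun x Hx => is_derive_opp _ _ _ (D C x Hx))
    ltac:(intros x Hx; specialize (Hb x Hx); apply Rabs_le_between in Hb;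
          assert (Q := exp_pos (C * x)); simpl; unfold opp; simpl; nra)
    (fun x Hx => continuity_pt_opp _ _ (Cn C x Hx)) t Ht).
  change (- (exp (C * t) * f t) <= - (exp (C * 0) * f 0)) in H.
  rewrite Rmult_0_r, exp_0 in H.
  assert (P0 := Hp t Ht); nra.
Qed.

(** Comparing cubes gives the factor [K ^ 2], and [K ^ 2 <= (K ^ 2) ^ 3] because [K >= 1]; the
    cruder constant avoids real powers of [K]. *)
Lemma two_thirds_comparison (K x y : R) :
  1 <= K -> 0 <= x -> 0 <= y -> x <= K * y ->
  nnpow x (2 / 3) <= K ^ 2 * nnpow y (2 / 3).
Proof.
intros HK Hx Hy H.
assert (K2 : 1 <= K ^ 2) by nra.
apply cube_le_reg.
- apply Rmult_le_pos; [lra | apply nnpow_nonneg].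
- rewrite Rpow_mult_distr, !nnpow_two_thirds_cube by easy.
  assert (x ^ 2 <= (K * y) ^ 2) by (apply pow_incr; lra).
  rewrite Rpow_mult_distr in H0.
  assert (K ^ 2 <= (K ^ 2) ^ 3).
  { rewrite <- (pow_1 (K ^ 2)) at 1; apply Rle_pow; [easy | lia]. }
  assert (Q := pow2_ge_0 y); nra.
Qed.

Lemma is_derive_velocity_mult (mu : R) (h f : R -> R) (x h' f' : R) :
  is_derive h x h' -> is_derive f x f' ->
  is_derive (fun y => (/ 2 * h y + mu * f y ^ 2) * f y) x
    ((/ 2 * h' + mu * (2 * f x * f')) * f x + (/ 2 * h x + mu * f x ^ 2) * f').
Proof.
intros Hh Hf; auto_derive; [repeat split; eexists; eassumption|].
change (Derive (fun x => f x) x) with (Derive f x).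
change (Derive (fun x => h x) x) with (Derive h x).
rewrite (is_derive_unique _ _ _ Hf), (is_derive_unique _ _ _ Hh); ring.
Qed.

Lemma hydrodynamic_profile_equation (mu T : R) (u0 : R -> R) (u ut : R -> R -> R) (t x : R) :
  0 < t < T -> hydrodynamic_solution mu T u0 u ->
  (forall y, continuous (u t) y) ->
  is_derive (fun s => u s x) t (ut t x) -> 0 < u t x ->
  2 / 3 * (rad (u t) x / u t x) * ut t x =
  profile_rhs mu (rad (u t) x) (rad1 (u t) x) (rad2 (u t) x) (rad3 (u t) x).
Proof.
intros Ht (Hnn & (_ & ut' & ux & _ & _ & Hd) & HG & _ & Heq) Hc Hut Hx.
assert (Ht' : 0 <= t <= T) by lra.
destruct (Heq t x Ht') as (l & bux & Hl & Hbux & Hsum).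
apply (is_dt_interior T u t x l Ht) in Hl.
apply is_derive_unique in Hl; rewrite (is_derive_unique (fun s => u s x) _ _ Hut) in Hl.
assert (G := proj1 (HG t Ht')); cbv beta in G.
assert (Hux := proj2 (Hd t x Ht')).
assert (D0 := Ck_derive_n 3 0 _ x G ltac:(lia)).
assert (D2 := Ck_derive_n 3 2 _ x G ltac:(lia)).
change (Derive_n (fun y => u t y ^ 2) 0) with (fun y => u t y ^ 2) in D0.
assert (E1 : 2 * u t x * ux t x = Derive_n (fun y => u t y ^ 2) 1 x).
{ rewrite <- (is_derive_unique (fun y => u t y ^ 2) x _ D0).
  symmetry; apply is_derive_unique.
  revert Hux; generalize (u t) (ux t x); intros f f' Hf.
  auto_derive; [eexists; eassumption|].
  change (Derive (fun x => f x) x) with (Derive f x).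
  rewrite (is_derive_unique _ _ _ Hf); ring. }
assert (Eb : bux = (/ 2 * Derive_n (fun y => u t y ^ 2) 3 x
    + mu * Derive_n (fun y => u t y ^ 2) 1 x) * u t x
  + (/ 2 * Derive_n (fun y => u t y ^ 2) 2 x + mu * u t x ^ 2) * ux t x).
{ apply is_derive_unique in Hbux; rewrite <- Hbux; apply is_derive_unique.
  unfold velocity; rewrite <- E1.
  exact (is_derive_velocity_mult mu _ _ x _ _ D2 Hux). }
assert (P := rad_pos (u t) x Hx).
rewrite <- (hydrodynamic_to_profile mu (u t x) (ux t x) (rad (u t) x)
  (rad1 (u t) x) (rad2 (u t) x) (rad3 (u t) x)
  (Derive_n (fun y => u t y ^ 2) 1 x) (Derive_n (fun y => u t y ^ 2) 2 x)
  (Derive_n (fun y => u t y ^ 2) 3 x)); try easy.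
- rewrite <- Eb; f_equal; lra.
- now apply rad_cube, Rlt_le.
- unfold rad1; field; lra.
- unfold rad2; field; lra.
- unfold rad3; field; lra.
Qed.

Lemma solution_profile (mu T : R) (u0 : R -> R) (u : R -> R -> R) :
  0 < T -> Rabs mu <= 1 -> hydrodynamic_solution mu T u0 u ->
  C_Ckb T 3 (fun t x => u t x ^ 2) ->
  C_Ckb T 2 (fun t x => nnpow (u t x) (4 / 3)) ->
  exists M rt r1 r2 r3,
    profile mu T M (rad u0) (fun t => rad (u (clamp T t))) rt r1 r2 r3.
Proof.
intros HT Hmu Hu HG HF.
assert (Hsol := Hu).
destruct Hu as (Hnn & (Hcs & ut & ux & Hcut & Hcux & Hd) & HCk & Hinit & _).
set (U := fun t x => u (clamp T t) x).
set (Ut := fun t x => ut (clamp T t) x).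
set (r := fun t => rad (u (clamp T t))).
destruct (C_Ckb_uniform_bound T 3 0 _ HT HG ltac:(lia)) as [M0 HM0].
destruct (C_Ckb_uniform_bound T 3 3 _ HT HG ltac:(lia)) as [M3 HM3].
destruct (C_Ckb_uniform_bound T 2 2 _ HT HF ltac:(lia)) as [N2 HN2].
pose (B := 1 + Rabs M0 + Rabs M3 + Rabs N2).
assert (BB : 1 <= B /\ M0 <= B /\ M3 <= B /\ N2 <= B).
{ assert (X0 := Rabs_pos M0); assert (X3 := Rabs_pos M3); assert (X2 := Rabs_pos N2).
  assert (Y0 := Rle_abs M0); assert (Y3 := Rle_abs M3); assert (Y2 := Rle_abs N2).
  unfold B; lra. }
clearbody B; destruct BB as (B1 & B0 & B3 & B2).
assert (CU : forall t x, continuity_2d_pt U t x)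
  by (intros t x; now apply continuity_2d_pt_clamp).
assert (CUt : forall t x, continuity_2d_pt Ut t x)
  by (intros t x; now apply continuity_2d_pt_clamp).
assert (UP : forall t x, 0 <= U t x) by (intros t x; apply Hnn, clamp_in, HT).
assert (Cx : forall t, 0 <= t <= T -> forall x, continuous (u t) x).
{ intros t Ht x; assert (X := continuous_slice _ _ _ (CU t x)).
  unfold U in X; now rewrite clamp_id in X. }
assert (Cr : forall t x, continuity_2d_pt r t x).
{ intros t x; apply (continuity_1d_2d_pt_comp (fun y => nnpow y (2 / 3)) U).
  - now apply continuity_pt_nnpow_two_thirds.
  - apply CU. }
assert (r3 : forall t x, r t x ^ 3 = U t x ^ 2) by (intros t x; apply rad_cube, UP).
assert (rP : forall t x, 0 <= r t x) by (intros t x; apply nnpow_nonneg).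
assert (rB : forall t x, r t x <= B).
{ intros t x; apply cube_le_reg; [lra|]; rewrite r3.
  assert (X := HM0 (clamp T t) x (clamp_in T t HT)).
  change (Rabs (U t x ^ 2) <= M0) in X.
  assert (Y := Rle_abs (U t x ^ 2)).
  assert (B <= B ^ 3) by (rewrite <- (pow_1 B) at 1; apply Rle_pow; [easy|lia]).
  lra. }
assert (dU : forall t x, 0 < t < T -> is_derive (fun s => U s x) t (Ut t x)).
{ intros t x Ht; unfold Ut; rewrite clamp_id by lra.
  apply (is_derive_ext_loc (fun s => u s x)).
  - generalize (locally_open_interval T t Ht); apply filter_imp; intros s Hs.
    unfold U; rewrite clamp_id; lra.
  - apply (is_dt_interior T u t x _ Ht), Hd; lra. }
assert (jets : forall t x, 0 <= t <= T -> 0 < u t x ->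
  Rabs (rad1 (u t) x) <= B /\ Rabs (rad (u t) x * rad2 (u t) x) <= 2 * B ^ 2 /\
  Rabs (rad (u t) x ^ 2 * rad3 (u t) x) <= 15 * B ^ 3).
{ intros t x Ht Hx; apply rad_jet_bounds; try easy.
  - apply (HCk t Ht).
  - intros y; apply Rle_trans with (1 := HM3 t y Ht); easy.
  - apply (HF t Ht).
  - intros y; apply Rle_trans with (1 := HN2 t y Ht); easy.
  - now apply Cx. }
(* Where [U] vanishes so does [r], so the quotient is 0 whatever the inverse of 0 is. *)
pose (rt := fun t x => 2 / 3 * (r t x / U t x) * Ut t x).
assert (eqn : forall t x, 0 < t < T -> rt t x =
  profile_rhs mu (r t x) (rad1 (U t) x) (rad2 (U t) x) (rad3 (U t) x)).
{ intros t x Ht; destruct (UP t x) as [Hx|Hx].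
  - unfold rt, r; unfold U, Ut in *; rewrite clamp_id in * by lra.
    apply hydrodynamic_profile_equation with (T := T) (u0 := u0); try easy.
    + apply Cx; lra.
    + apply (is_dt_interior T u t x _ Ht), Hd; lra.
  - unfold rt; assert (Z : r t x = 0) by (apply nnpow_zero; unfold U in Hx; lra).
    rewrite Z; unfold profile_rhs, Rdiv; ring. }
assert (rtB : forall t x, 0 < t < T -> Rabs (rt t x) <= 38 * B ^ 3 * r t x).
{ intros t x Ht; destruct (UP t x) as [Hx|Hx].
  - rewrite eqn by easy.
    assert (J := jets t x ltac:(lra)).
    unfold r; unfold U in *; rewrite clamp_id in * by lra.
    destruct (J Hx) as (J1 & J2 & J3).
    apply profile_rhs_bound; try easy; split; [apply nnpow_nonneg|].
    assert (X := rB t x); unfold r in X; now rewrite clamp_id in X by lra.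
  - unfold rt; assert (Z : r t x = 0) by (apply nnpow_zero; unfold U in Hx; lra).
    rewrite Z; unfold Rdiv; rewrite !Rmult_0_l, Rmult_0_r, Rmult_0_l, Rabs_R0; lra. }
assert (B30 : 1 <= B ^ 3) by (now apply pow_R1_Rle).
(* Where [U > 0], the bound on [rt] is converted with [57 = 3/2 * 38]. At a zero, [U] is minimal in
   time, so its time derivative is 0. *)
assert (UtB : forall t x, 0 < t < T -> Rabs (Ut t x) <= 57 * B ^ 3 * U t x).
{ intros t x Ht; destruct (UP t x) as [Hx|Hx].
  - assert (P : 0 < r t x) by (now apply nnpow_pos).
    replace (Ut t x) with (3 / 2 * (U t x / r t x) * rt t x) by (unfold rt; field; lra).
    rewrite Rabs_mult, Rabs_pos_eq.
    + replace (57 * B ^ 3 * U t x) with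
        (3 / 2 * (U t x / r t x) * (38 * B ^ 3 * r t x)) by (field; lra).
      apply Rmult_le_compat_l; [|now apply rtB].
      apply Rmult_le_pos; [lra|]; now apply Rlt_le, Rdiv_lt_0_compat.
    + apply Rmult_le_pos; [lra|]; now apply Rlt_le, Rdiv_lt_0_compat.
  - rewrite (derive_zero_of_minimum (fun s => U s x) T t (Ut t x) Ht), Rabs_R0.
    + rewrite <- Hx; lra.
    + intros s Hs; rewrite <- Hx; apply UP.
    + now apply dU. }
pose (K := exp (57 * B ^ 3 * T)).
assert (K1 : 1 <= K).
{ unfold K; rewrite <- exp_0; apply exp_le; apply Rmult_le_pos; lra. }
assert (comp : forall t x, 0 <= t <= T -> U t x <= K * u0 x /\ u0 x <= K * U t x).
{ intros t x Ht; rewrite <- Hinit.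
  replace (u 0 x) with (U 0 x) by (unfold U; rewrite clamp_id; lra).
  apply (exp_comparison T (57 * B ^ 3) (fun t => U t x) (fun t => Ut t x)); auto.
  - intros s Hs; apply continuity_pt_filterlim.
    apply (continuous_slice (fun x s => U s x)).
    intros eps; destruct (CU s x eps) as [d Hd']; exists d; intros; now apply Hd'.
  - lra. }
assert (u0P : forall x, 0 <= u0 x) by (intros x; rewrite <- Hinit; apply Hnn; lra).
assert (K2 : 1 <= K ^ 2) by (now apply pow_R1_Rle).
assert (BQ : B <= B ^ 3) by (rewrite <- (pow_1 B) at 1; apply Rle_pow; [easy|lia]).
assert (BS : B ^ 2 <= B ^ 3) by (apply Rle_pow; [easy|lia]).
assert (zero : forall t x, 0 <= t <= T -> u0 x = 0 -> U t x = 0).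
{ intros t x Ht Hx; destruct (comp t x Ht) as [X _]; rewrite Hx, Rmult_0_r in X.
  assert (Y := UP t x); lra. }
assert (upos : forall t x, 0 <= t <= T -> 0 < rad u0 x -> 0 < u t x).
{ intros t x Ht Hx; destruct (comp t x Ht) as [_ X].
  unfold U in X; rewrite clamp_id in X by easy.
  destruct (u0P x) as [P|P]; [nra|].
  unfold rad in Hx; rewrite nnpow_zero in Hx; lra. }
(* [15 * B ^ 3] dominates the jets, the sup bound and the linear growth from zeros; [K ^ 2] is the
   comparison constant. *)
exists (15 * B ^ 3 + K ^ 2), rt, (fun t => rad1 (U t)), (fun t => rad2 (U t)),
  (fun t => rad3 (U t)).
constructor.
- exact Cr.
- intros x; unfold r, rad; rewrite clamp_id by lra; now rewrite Hinit.
- intros t x _; split; [apply rP|]; apply Rle_trans with (1 := rB t x); lra.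
- intros t x Ht; destruct (comp t x Ht) as [X1 X2].
  assert (Y1 := two_thirds_comparison K _ _ K1 (UP t x) (u0P x) X1).
  assert (Y2 := two_thirds_comparison K _ _ K1 (u0P x) (UP t x) X2).
  change (nnpow (U t x) (2 / 3)) with (r t x) in *.
  change (nnpow (u0 x) (2 / 3)) with (rad u0 x) in *.
  fold r; assert (Z1 := rP t x).
  assert (Z2 : 0 <= rad u0 x) by apply nnpow_nonneg.
  split; nra.
(* Glaeser's inequality at [z] kills the first derivative of the squared datum, so Taylor gives
   [rad u0 x ^ 2 <= B (x - z)^2]. *)
- intros z x Hz.
  assert (T0 : 0 <= 0 <= T) by lra.
  assert (F2 := proj1 (proj1 (HF 0 T0))); cbv beta in F2.
  assert (NB := fun y => Rle_trans _ _ _ (HN2 0 y T0) B2); cbv beta in NB.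
  assert (Er : forall y, nnpow (u 0 y) (4 / 3) = rad u0 y ^ 2).
  { intros y; rewrite Hinit; symmetry; apply nnpow_two_thirds_sqr. }
  assert (D := derive_sqr_le_of_nonneg _ B z ltac:(lra) F2
    (fun y => nnpow_nonneg _ _) NB); cbv beta in D.
  rewrite Er, Hz in D.
  assert (D0 : Derive_n (fun y => nnpow (u 0 y) (4 / 3)) 1 z = 0).
  { set (d := Derive_n _ 1 z) in *; nra. }
  assert (Q := quadratic_upper_bound _ B z (x - z) F2 NB); cbv beta in Q.
  rewrite D0 in Q; replace (z + (x - z)) with x in Q by ring.
  rewrite !Er, Hz in Q.
  assert (Pz := Rabs_pos (x - z)).
  apply Rle_trans with (B * Rabs (x - z)); [|apply Rmult_le_compat_r; lra].
  apply Rsqr_incr_0_var; [|apply Rmult_le_pos; lra].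
  rewrite !Rsqr_pow2, Rpow_mult_distr, pow2_abs.
  assert (S := pow2_ge_0 (x - z)); nra.
- intros t x Ht; destruct (UP t x) as [Hx|Hx].
  + assert (A := is_derive_comp (fun y => Rpower y (2 / 3)) (fun s => U s x) t
      (2 / 3 * / U t x * Rpower (U t x) (2 / 3)) _
      ltac:(unfold Rpower; auto_derive; [easy | unfold Rdiv; ring]) (dU t x Ht)).
    apply (is_derive_ext_loc (fun s => Rpower (U s x) (2 / 3))).
    * assert (Cs : continuous (fun s => U s x) t)
        by exact (is_derive_continuous _ _ _ (dU t x Ht)).
      apply (filter_imp (fun s => 0 < U s x)); [|exact (Cs _ (open_gt 0 (U t x) Hx))].
      intros s Hs; symmetry; now apply nnpow_Rpower.
    * match type of A with is_derive _ _ ?l => replace (rt t x) with l; [exact A|] end.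
      rewrite <- nnpow_Rpower by easy.
      change (Ut t x * (2 / 3 * / U t x * r t x) = rt t x).
      unfold rt; field; lra.
  (* A zero at one time is a zero of the datum, hence at all times: [r] is constantly 0 in time at
     this [x]. *)
  + assert (U00 : u0 x = 0).
    { destruct (comp t x ltac:(lra)) as [_ X]; rewrite <- Hx, Rmult_0_r in X.
      assert (Y := u0P x); lra. }
    assert (Z : forall s, 0 <= s <= T -> r s x = 0).
    { intros s Hs; apply nnpow_zero; fold (U s x); rewrite (zero s x Hs U00); lra. }
    unfold rt; rewrite (Z t) by lra; unfold Rdiv.
    rewrite Rmult_0_l, Rmult_0_r, Rmult_0_l.
    apply (is_derive_ext_loc (fun _ => 0)).
    * generalize (locally_open_interval T t Ht); apply filter_imp; intros s Hs.
      symmetry; apply Z; lra.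
    * apply (is_derive_const (K := R_AbsRing) (V := R_NormedModule)).
- intros t x Ht; destruct (UP t x) as [Hx|Hx].
  + unfold rt, Rdiv.
    repeat apply continuity_2d_pt_mult; auto using continuity_2d_pt_const.
    apply continuity_2d_pt_inv; [apply CU | lra].
  (* The quotient formula is of no use at a zero; continuity follows from [|rt| <= 38 B^3 r] and
     continuity of [r]. *)
  + assert (Z : r t x = 0) by (apply nnpow_zero; unfold U in Hx; lra).
    intros eps.
    assert (Hp : 0 < eps / (38 * B ^ 3)) by (apply Rdiv_lt_0_compat; [apply cond_pos | lra]).
    assert (L1 := Cr t x (mkposreal _ Hp)).
    assert (L2 := locally_2d_first _ t x (locally_open_interval T t Ht)).
    generalize (locally_2d_and _ _ _ _ L1 L2).
    apply locally_2d_impl, locally_2d_forall; intros s y [H1 H2].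
    change (Rabs (r s y - r t x) < eps / (38 * B ^ 3)) in H1.
    replace (rt t x) with 0 by (unfold rt, Rdiv; rewrite Z; ring).
    rewrite Rminus_0_r; apply Rle_lt_trans with (1 := rtB s y H2).
    rewrite Z, Rminus_0_r, Rabs_pos_eq in H1 by apply rP.
    apply Rmult_lt_compat_l with (r := 38 * B ^ 3) in H1; [|lra].
    replace (38 * B ^ 3 * (eps / (38 * B ^ 3))) with (pos eps) in H1 by (field; lra).
    exact H1.
- exact eqn.
- intros t x Ht Hx.
  assert (P := upos t x ltac:(lra) Hx).
  assert (C0 := Cx t ltac:(lra) x).
  unfold r, U; rewrite clamp_id by lra.
  assert (G3 := proj1 (HCk t ltac:(lra))); cbv beta in G3.
  split; [now apply is_derive_rad|split; [now apply is_derive_rad1|split]].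
  + now apply is_derive_rad2.
  + now apply continuous_rad3.
- intros t x Ht Hx.
  assert (P := upos t x ltac:(lra) Hx).
  destruct (jets t x ltac:(lra) P) as (J1 & J2 & J3).
  change (U t) with (u (clamp T t)); unfold r; rewrite clamp_id by lra.
  repeat split; lra.
Qed.

(** Lets two solutions, each with its own constant, share the larger one. *)
Lemma profile_weaken mu T M M' r0 r rt r1 r2 r3 :
  0 < T -> M <= M' -> profile mu T M r0 r rt r1 r2 r3 ->
  profile mu T M' r0 r rt r1 r2 r3.
Proof.
intros HT HM Hr.
assert (B0 := fun x => profile_init_bounds x HT Hr).
destruct Hr as [H1 H2 H3 H4 H5 H6 H7 H8 H9 H10]; constructor; auto.
- intros t x Ht; specialize (H3 t x Ht); lra.
- intros t x Ht; specialize (H4 t x Ht); specialize (H3 t x Ht); specialize (B0 x).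
  split; nra.
- intros z x Hz; specialize (H5 z x Hz); assert (P := Rabs_pos (x - z)); nra.
- intros t x Ht Hx; destruct (H10 t x Ht Hx) as (X1 & X2 & X3); repeat split; lra.
Qed.

Theorem theorem1p4 :
  forall (mu T : R) (u0 : R -> R),
    (mu = -1 \/ mu = 0 \/ mu = 1) ->
    0 < T ->
    (forall x : R, 0 <= u0 x) ->
    Ckb 1 u0 ->
    Ckb 3 (fun x => u0 x ^ 2) ->
    Ckb 2 (fun x => nnpow (u0 x) (4 / 3)) ->
    forall u v : R -> R -> R,
      hydrodynamic_solution mu T u0 u ->
      C_Ckb T 3 (fun t x => u t x ^ 2) ->
      C_Ckb T 2 (fun t x => nnpow (u t x) (4 / 3)) ->
      hydrodynamic_solution mu T u0 v ->
      C_Ckb T 3 (fun t x => v t x ^ 2) ->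
      C_Ckb T 2 (fun t x => nnpow (v t x) (4 / 3)) ->
      forall t x : R, 0 <= t <= T -> u t x = v t x.
Proof.
intros mu T u0 Hmu HT _ _ _ _ u v Hu Hu3 Hu2 Hv Hv3 Hv2 t x Ht.
assert (Bmu : Rabs mu <= 1).
{ apply Rabs_le; destruct Hmu as [-> | [-> | ->]]; lra. }
destruct (solution_profile mu T u0 u HT Bmu Hu Hu3 Hu2)
  as (Mu & ut & u1 & u2 & u3 & Pu).
destruct (solution_profile mu T u0 v HT Bmu Hv Hv3 Hv2)
  as (Mv & vt & v1 & v2 & v3 & Pv).
apply profile_weaken with (M' := Rmax Mu Mv) in Pu; [|easy | apply Rmax_l].
apply profile_weaken with (M' := Rmax Mu Mv) in Pv; [|easy | apply Rmax_r].
assert (E := profile_unique t x HT Pu Pv Ht).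
cbv beta in E; rewrite clamp_id in E by easy.
assert (Nu := proj1 Hu t x Ht); assert (Nv := proj1 Hv t x Ht).
assert (Su := rad_cube (u t) x Nu); assert (Sv := rad_cube (v t) x Nv).
rewrite E, Sv in Su.
apply Rsqr_inj; [easy | easy |]; now rewrite !Rsqr_pow2.
Qed.
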